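(* Let $(A,\cdot,\Delta)$ be a real ASI bialgebra. Let $G$ be the set of coherent automorphisms on $(A,\cdot,\Delta)$ and $\mathfrak D$ be the set of coherent derivations on $(A,\cdot,\Delta)$. Then $G$ is a closed Lie subgroup of $\mathrm{GL}(A)^{\mathrm{op}}\times\mathrm{GL}(A)$ and $\mathfrak D$ is a Lie subalgebra of $\mathfrak{gl}(A)^{\mathrm{op}}\oplus\mathfrak{gl}(A)$. Moreover the Lie algebra of $G$ is exactly $\mathfrak D$.
   Context: All vector spaces and algebras are finite-dimensional, here over $\mathbb R$; ''algebra'' means associative algebra, not necessarily unital. $\sigma(a\otimes b)=b\otimes a$; $L_A(a)b=a\cdot b=R_A(b)a$. ASI bialgebra $(A,\cdot,\Delta)$: $(A,\cdot)$ is an algebra, $(A,\Delta)$ is a coassociative coalgebra (counit not required), and for all $a,b\in A$ $$\Delta(a\cdot b)=(R_A(b)\otimes\mathrm{id})\Delta(a)+(\mathrm{id}\otimes L_A(a))\Delta(b),$$ $$(L_A(a)\otimes\mathrm{id}-\mathrm{id}\otimes R_A(a))\Delta(b)=\sigma\big((\mathrm{id}\otimes R_A(b)-L_A(b)\otimes\mathrm{id})\Delta(a)\big).$$ Coherent derivation on $(A,\cdot,\Delta)$: a pair $(\partial,\eth)$ of linear maps $A\to A$ with $\partial$ a derivation of $(A,\cdot)$ and $\Delta\eth=(\eth\otimes\mathrm{id}+\mathrm{id}\otimes\eth)\Delta$, such that for all $a,b\in A$: $\eth(a)\cdot b=a\cdot\partial(b)+\eth(a\cdot b)$, $a\cdot\eth(b)=\partial(a)\cdot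 b+\eth(a\cdot b)$, $(\partial\otimes\mathrm{id})\Delta=(\mathrm{id}\otimes\eth)\Delta+\Delta\partial$, $(\mathrm{id}\otimes\partial)\Delta=(\eth\otimes\mathrm{id})\Delta+\Delta\partial$. Coherent automorphism on $(A,\cdot,\Delta)$: a pair $(\phi,\psi)$ of bijective linear maps $A\to A$ with $\phi$ an algebra endomorphism of $(A,\cdot)$ and $(\psi\otimes\psi)\Delta=\Delta\psi$, such that for all $a,b\in A$: $\psi(\phi(a)\cdot b)=a\cdot\psi(b)$, $\psi(a\cdot\phi(b))=\psi(a)\cdot b$, $(\mathrm{id}\otimes\phi)\Delta=(\psi\otimes\mathrm{id})\Delta\phi$, $(\phi\otimes\mathrm{id})\Delta=(\mathrm{id}\otimes\psi)\Delta\phi$. $\mathrm{GL}(A)^{\mathrm{op}}$ is the opposite Lie group of $\mathrm{GL}(A)$, so multiplication in $\mathrm{GL}(A)^{\mathrm{op}}\times\mathrm{GL}(A)$ is $(\alpha_1,\alpha_2)(\beta_1,\beta_2)=(\beta_1\alpha_1,\alpha_2\beta_2)$. $\mathfrak{gl}(A)^{\mathrm{op}}\oplus\mathfrak{gl}(A)$ has bracket $[(S_1,S_2),(T_1,T_2)]=(-[S_1,T_1],[S_2,T_2])$ with $[S,T]=ST-TS$; it is the Lie algebra of $\mathrm{GL}(A)^{\mathrm{op}}\times\mathrm{GL}(A)$. *)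

(* Defs.v *)
From HB Require Import structures.
From mathcomp Require Import all_boot all_order all_algebra.
From mathcomp Require Import all_classical all_reals all_analysis.
Set Implicit Arguments.
Unset Strict Implicit.
Unset Printing Implicit Defensive.
Import Order.TTheory GRing.Theory Num.Theory.
Import numFieldNormedType.Exports.
Import VectorInternalTheory.
Local Open Scope classical_set_scope.
Local Open Scope ring_scope.

(* V ⊗ W is realised as the space of dim V x dim W matrices, a pure tensor
   being the outer product of coordinate vectors; [tliftE] and [tensor_ext]
   give the universal property, through which all maps below are defined. *)
Section Tensor.
Variable F : fieldType.
Implicit Types U V W : vectType F.

Definition tensor V W : vectType F := 'M[F]_(dim V, dim W).

Definition tens V W (v : V) (w : W) : tensor V W := (v2r v)^T *m v2r w.

(* The linear map with v ⊗ w |-> f v w, for f bilinear. *)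
Definition tlift V W U (f : V -> W -> U) (t : tensor V W) : U :=
  \sum_i \sum_j t i j *: f (r2v (delta_mx 0 i)) (r2v (delta_mx 0 j)).

Definition tmap V W V' W' (f : V -> V') (g : W -> W') :
  tensor V W -> tensor V' W' := tlift (fun v w => tens (f v) (g w)).

Definition tswap V W : tensor V W -> tensor W V :=
  tlift (fun v w => tens w v).

Definition tassoc U V W : tensor (tensor U V) W -> tensor U (tensor V W) :=
  tlift (fun t w => tlift (fun u v => tens u (tens v w)) t).

Lemma tlift_linear V W U (f : V -> W -> U) : linear (tlift f).
Proof.
move=> c s t; rewrite /tlift scaler_sumr -big_split; apply: eq_bigr => i _ /=.
rewrite scaler_sumr -big_split; apply: eq_bigr => j _ /=.
by rewrite !mxE scalerDl scalerA.
Qed.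

HB.instance Definition _ V W U (f : V -> W -> U) :=
  GRing.isLinear.Build F (tensor V W) U _ (tlift f) (tlift_linear f).

Lemma tens_linearl V W (w : W) : linear (fun v : V => tens v w).
Proof. by move=> c v v'; rewrite /tens !linearP mulmxDl -scalemxAl. Qed.

Lemma tens_linearr V W (v : V) : linear (tens v : W -> tensor V W).
Proof. by move=> c w w'; rewrite /tens linearP mulmxDr -scalemxAr. Qed.

Lemma vec_sum V (v : V) :
  v = \sum_i v2r v 0 i *: r2v (delta_mx 0 i).
Proof.
rewrite -[LHS]v2rK [X in r2v X]row_sum_delta linear_sum.
by apply: eq_bigr => i _; rewrite linearZ.
Qed.

Lemma tliftE V W U (f : V -> W -> U) (v : V) (w : W) :
  (forall w, linear (f^~ w)) -> (forall v, linear (f v)) ->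
  tlift f (tens v w) = f v w.
Proof.
move=> fl fr.
pose fL w' : {linear V -> U} :=
  HB.pack (f^~ w') (GRing.isLinear.Build F V U *:%R (f^~ w') (fl w')).
pose fR v' : {linear W -> U} :=
  HB.pack (f v') (GRing.isLinear.Build F W U *:%R (f v') (fr v')).
rewrite [in RHS](vec_sum v) -[RHS]/(fL w _) linear_sum; apply: eq_bigr => i _.
rewrite linearZ /= [in RHS](vec_sum w) -[f _ _]/(fR _ _) linear_sum scaler_sumr.
apply: eq_bigr => j _; rewrite linearZ /= scalerA; congr (_ *: _).
by rewrite mxE big_ord1 mxE.
Qed.

Lemma tensor_ext V W U (f g : {linear tensor V W -> U}) :
  (forall v w, f (tens v w) = g (tens v w)) -> f =1 g.
Proof.
move=> fg t; rewrite (matrix_sum_delta t) !linear_sum; apply: eq_bigr => i _.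
rewrite !linear_sum; apply: eq_bigr => j _; rewrite !linearZ; congr (_ *: _).
have := fg (r2v (delta_mx 0 i)) (r2v (delta_mx 0 j)).
by rewrite /tens !r2vK trmx_delta mul_delta_mx.
Qed.

Lemma tmapE V W V' W' (f : {linear V -> V'}) (g : {linear W -> W'}) v w :
  tmap f g (tens v w) = tens (f v) (g w).
Proof.
apply: tliftE => [w' c x y|v' c x y]; rewrite linearP.
  exact: tens_linearl.
exact: tens_linearr.
Qed.

Lemma tswapE V W (v : V) (w : W) : tswap (tens v w) = tens w v.
Proof. by apply: tliftE => ?; [exact: tens_linearr|exact: tens_linearl]. Qed.

Lemma tassocE U V W (u : U) (v : V) (w : W) :
  tassoc (tens (tens u v) w) = tens u (tens v w).
Proof.
rewrite /tassoc tliftE; last 2 first.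
- by move=> w'; exact: tlift_linear.
- move=> t c x y; rewrite /tlift scaler_sumr -big_split; apply: eq_bigr => i _.
  rewrite /= scaler_sumr -big_split; apply: eq_bigr => j _ /=.
  by rewrite !tens_linearr scalerDr !scalerA mulrC.
apply: tliftE => [v'|u'] c x y; first exact: tens_linearl.
by rewrite tens_linearl tens_linearr.
Qed.

End Tensor.

Section ASI.
Variable F : fieldType.

Record asiBialgebra (A : vectType F) := AsiBialgebra {
  amul : {bilinear A -> A -> A};
  comul : 'Hom(A, tensor A A);
  amulA : associative amul;
  comulA : forall a,
    tassoc (tmap comul id (comul a)) = tmap id comul (comul a);
  comul_amul : forall a b,
    comul (amul a b)
      = tmap (amul^~ b) id (comul a) + tmap id (amul a) (comul b);
  comul_antisym : forall a b,
    tmap (amul a) id (comul b) - tmap id (amul^~ a) (comul b)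
      = tswap (tmap id (amul^~ b) (comul a) - tmap (amul b) id (comul a))
}.

Variables (A : vectType F) (B : asiBialgebra A).
Local Notation "a ⋅ b" := (amul B a b) (at level 40, left associativity).
Local Notation Δ := (comul B).

Record coherent_derivation (p : 'End(A) * 'End(A)) : Prop := {
  cder_der : forall a b, p.1 (a ⋅ b) = p.1 a ⋅ b + a ⋅ p.1 b;
  cder_coder : forall a,
    Δ (p.2 a) = tmap p.2 id (Δ a) + tmap id p.2 (Δ a);
  cder_mull : forall a b, p.2 a ⋅ b = a ⋅ p.1 b + p.2 (a ⋅ b);
  cder_mulr : forall a b, a ⋅ p.2 b = p.1 a ⋅ b + p.2 (a ⋅ b);
  cder_comull : forall a,
    tmap p.1 id (Δ a) = tmap id p.2 (Δ a) + Δ (p.1 a);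
  cder_comulr : forall a,
    tmap id p.1 (Δ a) = tmap p.2 id (Δ a) + Δ (p.1 a)
}.

Record coherent_automorphism (p : 'End(A) * 'End(A)) : Prop := {
  caut_bij1 : bijective p.1;
  caut_bij2 : bijective p.2;
  caut_mul : forall a b, p.1 (a ⋅ b) = p.1 a ⋅ p.1 b;
  caut_comul : forall a, tmap p.2 p.2 (Δ a) = Δ (p.2 a);
  caut_mull : forall a b, p.2 (p.1 a ⋅ b) = a ⋅ p.2 b;
  caut_mulr : forall a b, p.2 (a ⋅ p.1 b) = p.2 a ⋅ b;
  caut_comull : forall a, tmap id p.1 (Δ a) = tmap p.2 id (Δ (p.1 a));
  caut_comulr : forall a, tmap p.1 id (Δ a) = tmap id p.2 (Δ (p.1 a))
}.

End ASI.

Section Smooth.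
Variable R : realType.

(* The iterated-directional-derivative form of C^k; meant for finite
   dimensional domains (here R and R^n), where it is the usual notion. *)
Fixpoint Ck_on (V W : normedModType R) (k : nat) (U : set V) (f : V -> W) :
    Prop :=
  match k with
  | 0 => forall x, U x -> {for x, continuous f}
  | k'.+1 => (forall x, U x -> differentiable f x) /\
             (forall v, Ck_on k' U ('D_v f))
  end.

Definition smooth_on (V W : normedModType R) (U : set V) (f : V -> W) : Prop :=
  forall k, Ck_on k U f.

(* A finite dimensional space carries its unique Hausdorff vector topology and
   its standard smooth structure, both transported along the linear
   coordinates v2r : V -> R^(dim V). *)
Implicit Types V W : vectType R.

Definition vopen V (U : set V) : Prop := open (r2v @^-1` U).

Definition vclosed V (C : set V) : Prop := closed (r2v @^-1` C).

Definition vsmooth_on V W (U : set V) (f : V -> W) : Prop :=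
  smooth_on (r2v @^-1` U) (fun x : 'rV[R]_(dim V) => v2r (f (r2v x))).

(* Near each of its points, S is straightened onto a k-dimensional linear
   subspace by a smooth diffeomorphism f, with inverse g, between open sets. *)
Definition embedded_submanifold V (k : nat) (S : set V) : Prop :=
  forall p, S p -> exists (U U' : set V) (f g : V -> V) (E : {vspace V}),
    [/\ [/\ vopen U, vopen U' & U p],
        [/\ vsmooth_on U f, vsmooth_on U' g, f @` U = U' &
            forall x, U x -> g (f x) = x],
        \dim E = k &
        forall x, U x -> (S x <-> f x \in E)].

Definition tangent_space V (S : set V) (p : V) : set V :=
  [set X | exists (e : R) (c : R -> V),
    [/\ 0 < e,
        smooth_on `]-e, e[%classic (v2r \o c),
        (forall t, t \in `]-e, e[%R -> S (c t)),
        c 0 = p &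
        'D_1 (v2r \o c) 0 = v2r X]].

End Smooth.

Section LieSubgroup.
Variables (R : realType) (A : vectType R).
Implicit Types (x y : 'End(A) * 'End(A)) (G D : set ('End(A) * 'End(A))).

(* GL(A)^op x GL(A), as an open subset of End(A) x End(A). *)
Definition GLopGL : set ('End(A) * 'End(A)) :=
  [set x : 'End(A) * 'End(A) | bijective x.1 /\ bijective x.2].

Definition GLopGL_one : 'End(A) * 'End(A) := (\1%VF, \1%VF).

Definition GLopGL_mul x y : 'End(A) * 'End(A) :=
  ((y.1 \o x.1)%VF, (x.2 \o y.2)%VF).

Definition GLopGL_inv x : 'End(A) * 'End(A) := ((x.1^-1)%VF, (x.2^-1)%VF).

Definition gl_bracket (S T : 'End(A)) : 'End(A) := (S \o T)%VF - (T \o S)%VF.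

Definition glopgl_bracket x y : 'End(A) * 'End(A) :=
  (- gl_bracket x.1 y.1, gl_bracket x.2 y.2).

(* Closedness is relative to GL(A)^op x GL(A).  The group operations of G are
   automatically smooth, being restrictions to an embedded submanifold. *)
Record closed_Lie_subgroup G : Prop := {
  cls_sub : G `<=` GLopGL;
  cls_one : G GLopGL_one;
  cls_mul : forall x y, G x -> G y -> G (GLopGL_mul x y);
  cls_inv : forall x, G x -> G (GLopGL_inv x);
  cls_closed : exists C, vclosed C /\ G = GLopGL `&` C;
  cls_submanifold : exists k, embedded_submanifold k G
}.

Record Lie_subalgebra D : Prop := {
  lsa_zero : D 0;
  lsa_add : forall x y, D x -> D y -> D (x + y);
  lsa_scale : forall (c : R) x, D x -> D (c *: x);
  lsa_bracket : forall x y, D x -> D y -> D (glopgl_bracket x y)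
}.

(* The Lie algebra of a Lie subgroup, as a subspace of gl(A)^op + gl(A) (whose
   bracket it inherits). *)
Definition Lie_algebra_of G : set ('End(A) * 'End(A)) :=
  tangent_space G GLopGL_one.

End LieSubgroup.

(* Main.v *)
From HB Require Import structures.
Require Import Defs.
From mathcomp Require Import all_boot all_order all_algebra.
From mathcomp Require Import all_classical all_reals all_analysis.
From mathcomp Require Import ring lra.

(** The group of coherent automorphisms is an algebraic group, and its Lie algebra
    can be read off by linearising its equations. The proof makes this explicit
    without the exponential map and without the general closed subgroup theorem.

    A pair [x = (φ, ψ)] of invertible maps is a coherent automorphism exactly
    when a certain quadratic polynomial [F x], with six components, vanishes
    ([coherent_automorphismE]), and a pair is a coherent derivation exactly when
    it is killed by the derivative [K] of [F] at the identity
    ([coherent_derivationE]). Closedness of the group and linearity of the space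
    of derivations are then immediate, and the group and bracket closure are
    computations with composites of linear maps.

    The manifold structure rests on the identity
    [dF_x (x . Y) = L_x (K Y) + S_Y (F x)] ([coh_tangent_act]), where [x . Y] is
    the translate of the tangent vector [Y] and [L_x] is invertible. It says that
    [dF] has constant rank along the zero set of [F]. Fix a solution [p], put
    [T = dF_p] and let [s] be a linear map with [T s T = T]. The quadratic map
    [p + h |-> h + s (q h h)], [q] being the quadratic part of [F], is tangent to
    the identity, so it has a smooth local inverse ([quadratic_local_inverse]:
    contraction for existence, bootstrapping for smoothness). It is a chart that
    straightens the zero set to [ker T]. Zeros of [F] have coordinate in [ker T] by
    the choice of [s]. Conversely, along a segment in [ker T] the component of [F]
    in the image of [T] vanishes, so by the identity above the variation of [F] is
    bounded by [F] itself, and [F] stays zero by a Gronwall argument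
    ([transversal_step], [discrete_gronwall]). The dimension of [ker T] is that
    of [ker K] for all [p].

    At the identity [T = K]. The inverse chart maps lines in [ker K] to smooth
    curves of automorphisms, and differentiating [F (c t) = 0] gives the other
    inclusion, so the tangent space of the group is [ker K]. *)

Set Implicit Arguments.
Unset Strict Implicit.
Unset Printing Implicit Defensive.
Import Order.TTheory GRing.Theory Num.Theory.
Import numFieldNormedType.Exports.
Import VectorInternalTheory.
Local Open Scope classical_set_scope.
Local Open Scope ring_scope.

(** * Bounds in coordinate spaces *)

Section FiniteDimBounds.
Variable R : realType.

Lemma ler_coord_norm m n (M : 'M[R]_(m, n)) i j : `|M i j| <= `|M|.
Proof.
rewrite [leRHS]/Num.norm /= mx_normrE.
exact: (le_bigmax _ (fun ij : 'I_m * 'I_n => `|M ij.1 ij.2|) (i, j)).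
Qed.

Lemma mx_norm_le m n (M : 'M[R]_(m, n)) c :
  0 <= c -> (forall i j, `|M i j| <= c) -> `|M| <= c.
Proof.
move=> c0 Mc; rewrite [leLHS]/Num.norm /= mx_normrE.
by apply/bigmax_leP; split => // -[i j] _; exact: Mc.
Qed.

Lemma linear_rV_bounded n (W : normedModType R) (f : {linear 'rV[R]_n -> W}) :
  exists2 c, 0 <= c & forall x, `|f x| <= c * `|x|.
Proof.
exists (\sum_j `|f (delta_mx 0 j)|); first exact: sumr_ge0.
move=> x; rewrite [in leLHS](row_sum_delta x) linear_sum mulr_suml.
apply: le_trans (ler_norm_sum _ _ _) (ler_sum _ _) => j _.
by rewrite linearZ normrZ mulrC ler_wpM2l// ler_coord_norm.
Qed.

Lemma linear_rV_continuous n (W : normedModType R) (f : {linear 'rV[R]_n -> W}) :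
  continuous f.
Proof.
have [c c0 fc] := linear_rV_bounded f.
apply: bounded_linear_continuous; exists c; split; first by rewrite realE c0.
move=> e ce; apply/nbhs_ballP; exists 1 => //= x.
rewrite -ball_normE /= sub0r normrN => x1.
by rewrite (le_trans (fc x))// (le_trans _ (ltW ce))// ler_piMr// ltW.
Qed.

Lemma norm_mulmx_le m n p (M : 'M[R]_(m, n)) (N : 'M[R]_(n, p)) :
  `|M *m N| <= n%:R * `|M| * `|N|.
Proof.
apply: mx_norm_le => [|i j]; first by rewrite !mulr_ge0.
rewrite mxE (le_trans (ler_norm_sum _ _ _))//.
rewrite -mulrA -[n in n%:R]card_ord mulr_natl -sumr_const ler_sum// => k _.
by rewrite normrM ler_pM// ler_coord_norm.
Qed.

Lemma mulmx_continuous m n p :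
  continuous (fun z : 'M[R]_(m, n) * 'M[R]_(n, p) => z.1 *m z.2).
Proof.
move=> [M N]; apply/cvgrPdist_lt => e e0.
pose c := n%:R * (`|M| + `|N| + 1) + 1.
have nn0 : 0 <= n%:R :> R by [].
have M0 := normr_ge0 M; have N0 := normr_ge0 N.
have c0 : 0 < c by rewrite /c; nra.
have e'0 : 0 < Num.min 1 (e / c) by rewrite lt_min ltr01 divr_gt0.
have near_ball := nbhsx_ballx ((M, N) : _ * _) _ e'0.
near=> z.
have zd : `|(M, N) - z| < Num.min 1 (e / c).
  suff : ball ((M, N) : _ * _) (Num.min 1 (e / c)) z by rewrite -ball_normE.
  by near: z.
have [z1 z2] : `|M - z.1| <= `|(M, N) - z| /\ `|N - z.2| <= `|(M, N) - z|.
  by rewrite !num_le_max !lexx orbT.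
move: zd; rewrite lt_min => /andP[zd1 zd2].
set d := `|_ - z| in z1 z2 zd1 zd2.
have -> : M *m N - z.1 *m z.2
    = (M - z.1) *m N + M *m (N - z.2) - (M - z.1) *m (N - z.2).
  set D1 := M - z.1; set D2 := N - z.2.
  have -> : z.1 = M - D1 by rewrite opprB addrC subrK.
  have -> : z.2 = N - D2 by rewrite opprB addrC subrK.
  rewrite !mulmxBl !mulmxBr.
  move: (M *m N) (M *m D2) (D1 *m N) (D1 *m D2) => a b c' d'.
  by apply/matrixP => i j; rewrite !mxE; ring.
have h1 := norm_mulmx_le (M - z.1) N.
have h2 := norm_mulmx_le M (N - z.2).
have h3 := norm_mulmx_le (M - z.1) (N - z.2).
rewrite (le_lt_trans (ler_normB _ _))//.
rewrite (le_lt_trans (lerD (ler_normD _ _) (lexx _)))//.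
have : d * c < e by rewrite -ltr_pdivlMr.
apply: le_lt_trans.
have -> : d * c = n%:R * d * `|N| + n%:R * `|M| * d + n%:R * d * 1 + d.
  by rewrite /c; ring.
have d0 : 0 <= d := normr_ge0 _.
rewrite -[leLHS]addr0; apply: lerD => //; apply: lerD; first apply: lerD.
- by rewrite (le_trans h1)// ler_wpM2r// ler_wpM2l.
- by rewrite (le_trans h2)// ler_wpM2l// mulr_ge0.
- rewrite (le_trans h3)// ler_pM// ?mulr_ge0// ?ler_wpM2l//.
  by rewrite (le_trans z2)// ltW.
Unshelve. all: by end_near. Qed.

End FiniteDimBounds.

(** * Calculus of maps of class C^k *)

Section Calculus.
Variable R : realType.
Implicit Types V W X : normedModType R.

(** Every map differentiated below is quadratic, or a local inverse of a
    quadratic map, or the matrix inverse of the derivative of one; in each case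
    the Taylor remainder is visibly [O(|h|^2)]. *)
Lemma is_diff_quadratic_remainder V W (f : V -> W) (df : {linear V -> W}) x c :
  continuous df ->
  (\forall h \near 0, `|f (h + x) - f x - df h| <= c * `|h| ^+ 2) ->
  is_diff x f df.
Proof.
move=> dfc fx.
suff E : f \o shift x = cst (f x) + df +o_ 0 id.
  have dE : 'd f x = df :> (V -> W) by exact: diff_unique.
  by split=> //; apply/diff_locallyP; rewrite dE.
apply: eqaddoE; rewrite funeqE => h /=.
pose r h := f (h + x) - f x - df h.
have -> : f (h + x) = f x + df h + r h.
  by rewrite [f x + _]addrC [RHS]addrC addrA !subrK.
congr (_ + _).
suff ro : r =o_ 0 (id : V -> V) by rewrite ro.
apply/eqoP => e e0; near=> y.
have yc : `|y| < e / (`|c| + 1).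
  near: y; apply/nbhs_ballP; exists (e / (`|c| + 1)).
    by rewrite /= divr_gt0// ltr_wpDl.
  by move=> y; rewrite -ball_normE /= sub0r normrN.
apply: (@le_trans _ _ (c * `|y| ^+ 2)); first by near: y.
rewrite expr2 mulrA ler_wpM2r// (@le_trans _ _ (`|c| * `|y|))//.
  by rewrite ler_wpM2r// ler_norm.
move: yc; rewrite ltr_pdivlMr ?ltr_wpDl//.
move=> /ltW; apply: le_trans; rewrite mulrC ler_wpM2l//.
by rewrite lerDl.
Unshelve. all: by end_near. Qed.

(** Differentiability is local because [g = f + (g - f)], and [g - f] vanishes
    near the point, so it has the zero map as a quadratic-remainder derivative. *)
Lemma near_eq_is_diff V W (f g : V -> W) x (df : V -> W) :
  (\forall y \near x, f y = g y) -> is_diff x f df -> is_diff x g df.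
Proof.
move=> fg dfx.
suff h0 : is_diff x (g - f) (0 : V -> W).
  have -> : g = f + (g - f) by rewrite addrC subrK.
  by rewrite -[df]addr0; exact: is_diffD.
have c0 : continuous (\0 : {linear V -> W}) by move=> y; exact: cst_continuous.
apply: (@is_diff_quadratic_remainder _ _ _ \0 _ 0) => //=.
have fgx : f x = g x by exact: (nbhs_singleton fg).
have : \forall h \near (0 : V), f (h + x) = g (h + x).
  have := fg; rewrite (near_shift 0); apply: filterS => h /=.
  by rewrite subr0.
apply: filterS => h hfg.
have gf0 y : f y = g y -> (g - f) y = 0.
  by move=> e; rewrite -[LHS]/(g y - f y) e subrr.
by rewrite mul0r !gf0// !subrr normr0.
Qed.

Lemma near_eq_differentiable V W (f g : V -> W) x :
  (\forall y \near x, f y = g y) -> differentiable f x -> differentiable g x.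
Proof. by move=> fg /differentiableP /(near_eq_is_diff fg) []. Qed.

Lemma is_diff_derive V W (f : V -> W) x df v : is_diff x f df -> 'D_v f x = df v.
Proof. by move=> [dfx <-]; rewrite deriveE. Qed.

Lemma Ck_on_continuous V W k (U : set V) (f : V -> W) :
  Ck_on k U f -> forall x, U x -> {for x, continuous f}.
Proof. by case: k => [//|k] [df _] x /df; exact: differentiable_continuous. Qed.

Lemma Ck_on_succW V W k (U : set V) (f : V -> W) : Ck_on k.+1 U f -> Ck_on k U f.
Proof.
elim: k f => [|k IHk] f; first by move=> h x Ux; exact: (Ck_on_continuous h).
by move=> [df Df]; split=> // v; apply: IHk.
Qed.

Lemma Ck_on_sub V W k (U U' : set V) (f : V -> W) :
  U' `<=` U -> Ck_on k U f -> Ck_on k U' f.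
Proof.
move=> UU; elim: k f => [|k IHk] f /=; first by move=> fc x /UU /fc.
by move=> [df Df]; split=> [x /UU /df//|v]; exact: IHk.
Qed.

(** Iterated directional derivatives are computed by formulas valid on an open
    set only, so the induction on [k] has to replace a derivative by a formula
    that agrees with it there. *)
Lemma Ck_on_eq V W k (U : set V) (f g : V -> W) :
  open U -> (forall x, U x -> f x = g x) -> Ck_on k U f -> Ck_on k U g.
Proof.
move=> oU; elim: k f g => [|k IHk] f g fg.
  move=> fc x Ux; rewrite /prop_for /continuous_at -(fg _ Ux).
  apply: cvg_trans (fc x Ux); apply: near_eq_cvg.
  by near=> y; apply: fg; near: y; exact: open_nbhs_nbhs.
have fgn x : U x -> \forall y \near x, f y = g y.
  by move=> Ux; near=> y; apply: fg; near: y; exact: open_nbhs_nbhs.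
move=> [df Df]; split=> [x Ux|v].
  exact: near_eq_differentiable (fgn x Ux) (df x Ux).
by apply: IHk (Df v) => x Ux; apply: near_eq_derive; exact: fgn.
Unshelve. all: by end_near. Qed.

Lemma Ck_on_cst V W k (U : set V) (a : W) : Ck_on k U (cst a).
Proof.
elim: k a => [|k IHk] a; first by move=> x _; exact: cst_continuous.
split=> // v; have -> : 'D_v (cst a) = cst (0 : W).
  by rewrite funeqE => x; rewrite derive_cst.
exact: IHk.
Qed.

Lemma Ck_on_lin V W k (U : set V) (f : {linear V -> W}) :
  continuous f -> Ck_on k U f.
Proof.
move=> fc; case: k => [|k]; first by move=> x _; exact: fc.
split=> [x _|v]; first exact: linear_differentiable.
have -> : 'D_v f = cst (f v).
  rewrite funeqE => x; rewrite deriveE; last exact: linear_differentiable.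
  by rewrite diff_lin.
exact: Ck_on_cst.
Qed.

Lemma Ck_onD V W k (U : set V) (f g : V -> W) : open U ->
  Ck_on k U f -> Ck_on k U g -> Ck_on k U (f \+ g).
Proof.
move=> oU; elim: k f g => [|k IHk] f g.
  by move=> fc gc x Ux; apply: continuousD; [exact: fc|exact: gc].
move=> [df Df] [dg Dg]; split=> [x Ux|v].
  by apply: differentiableD; [exact: df|exact: dg].
apply: Ck_on_eq (IHk _ _ (Df v) (Dg v)) => // x Ux.
by rewrite /= -[f \+ g]/(f + g) deriveD//; apply: diff_derivable; [exact: df|exact: dg].
Qed.

Lemma Ck_on_lin_comp V W X k (U : set V) (l : {linear W -> X}) (f : V -> W) :
  continuous l -> open U -> Ck_on k U f -> Ck_on k U (l \o f).
Proof.
move=> lc oU; elim: k f => [|k IHk] f.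
  by move=> fc x Ux; apply: continuous_comp; [exact: fc|exact: lc].
move=> [df Df].
have dl y : differentiable l y by exact: linear_differentiable.
split=> [x Ux|v].
  by apply: differentiable_comp => //; exact: df.
apply: Ck_on_eq (IHk _ (Df v)) => // x Ux.
have h := is_diff_comp (differentiableP (df x Ux)) (differentiableP (dl (f x))).
by rewrite (is_diff_derive v h) /= diff_lin// deriveE//; exact: df.
Qed.

Lemma Ck_on_comp_lin V W X k (U : set W) (l : {linear V -> W}) (f : W -> X) :
  continuous l -> open U -> Ck_on k U f -> Ck_on k (l @^-1` U) (f \o l).
Proof.
move=> lc oU; elim: k f => [|k IHk] f.
  by move=> fc x Ux; apply: continuous_comp; [exact: lc|exact: fc].
move=> [df Df].
have dl y : differentiable l y by exact: linear_differentiable.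
have oU' : open (l @^-1` U) by apply: open_comp => // x _; exact: lc.
split=> [x Ux|v].
  by apply: differentiable_comp => //; exact: df.
apply: Ck_on_eq (IHk _ (Df (l v))) => // x Ux.
have h := is_diff_comp (differentiableP (dl x)) (differentiableP (df (l x) Ux)).
by rewrite (is_diff_derive v h) /= diff_lin// deriveE//; exact: df.
Qed.

Lemma derive_mulmx V m n p (f : V -> 'M[R]_(m, n)) (g : V -> 'M[R]_(n, p)) x :
  differentiable f x -> differentiable g x ->
  is_diff x (fun y => f y *m g y)
    (fun v => f x *m 'D_v g x + 'D_v f x *m g x).
Proof.
move=> df dg.
pose mm : {bilinear 'M[R]_(m, n) -> 'M[R]_(n, p) -> 'M[R]_(m, p)} := mulmx.
have mc : continuous (fun z => mm z.1 z.2) by exact: mulmx_continuous.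
have mmd := differentiable_bilin (f x, g x) mc.
have fg : differentiable (fun y => (f y, g y)) x by exact: differentiable_pair.
have -> : (fun y => f y *m g y) = (fun z => mm z.1 z.2) \o (fun y => (f y, g y)).
  by [].
split; first exact: differentiable_comp.
rewrite diff_comp// diff_bilin// funeqE => v /=.
by rewrite diff_pair//= !deriveE.
Qed.

(** Leibniz rule: each directional derivative of the product is a sum of two
    products of maps of class [C^k]. *)
Lemma Ck_on_mulmx V m n p k U (f : V -> 'M[R]_(m, n)) (g : V -> 'M[R]_(n, p)) :
  open U -> Ck_on k U f -> Ck_on k U g -> Ck_on k U (fun y => f y *m g y).
Proof.
move=> oU; elim: k f g => [|k IHk] f g.
  move=> fc gc x Ux.
  have fgc : {for x, continuous (fun y => (f y, g y))}.
    exact: (cvg_pair (fc x Ux) (gc x Ux)).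
  exact: (continuous_comp fgc (@mulmx_continuous _ m n p (f x, g x))).
move=> Cf Cg; have [df Df] := Cf; have [dg Dg] := Cg.
split=> [x Ux|v].
  by have [] := derive_mulmx (df x Ux) (dg x Ux).
have h := Ck_onD oU (IHk _ _ (Ck_on_succW Cf) (Dg v))
                    (IHk _ _ (Df v) (Ck_on_succW Cg)).
apply: Ck_on_eq h => // x Ux /=.
by rewrite (is_diff_derive _ (derive_mulmx (df x Ux) (dg x Ux))).
Qed.

End Calculus.

(** * Smooth local inverses of quadratic maps *)

HB.instance Definition _ (R : realType) m n :=
  Uniform_isComplete.Build 'M[R]_(m, n) cauchy_cvg.

(** The quadratic map [h + b h h] for a bilinear [b] is studied in matrix form:
    [N] and [P] freeze one argument of [b] each, [b h k = h *m N k = k *m P h].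
    Its derivative at [h] is then right multiplication by [1 + (N h + P h)]. *)
Section QuadraticInverse.
Variables (R : realType) (n : nat) (N P : {linear 'rV[R]_n -> 'M[R]_n}).
Implicit Types x y h d k : 'rV[R]_n.
Hypothesis NP : forall h k, h *m N k = k *m P h.

Definition qmap h := h + h *m N h.
Definition qdiff h : 'M[R]_n := 1%:M + (N h + P h).

Lemma qmap0 : qmap 0 = 0.
Proof. by rewrite /qmap mul0mx addr0. Qed.

Lemma qmapD h d : qmap (h + d) = qmap h + d *m qdiff h + d *m N d.
Proof.
rewrite /qmap /qdiff linearD !mulmxDl !mulmxDr mulmx1 -(NP h d).
move: (h *m _) (d *m _) (h *m _) (d *m _) => a b c' d'.
by apply/matrixP => i j; rewrite !mxE; ring.
Qed.

Lemma qmap_bounds : exists c, [/\ 1 <= c,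
  forall x y, `|x *m N y| <= c * `|x| * `|y|,
  forall x y, `|x *m (N y + P y)| <= c * `|x| * `|y| &
  forall y, `|N y + P y| <= c * `|y| ].
Proof.
have [a a0 aN] := linear_rV_bounded N.
have [b b0 bP] := linear_rV_bounded P.
have nn0 : 0 <= n%:R :> R by [].
exists (1 + (n%:R + 1) * (a + b)).
have NPle y : `|N y + P y| <= (a + b) * `|y|.
  by rewrite (le_trans (ler_normD _ _))// mulrDl lerD.
have prod_le (x : 'rV[R]_n) y (M : 'M[R]_n) : `|M| <= (a + b) * `|y| ->
    `|x *m M| <= (1 + (n%:R + 1) * (a + b)) * `|x| * `|y|.
  move=> Mle; rewrite (le_trans (norm_mulmx_le _ _))//.
  have x0 := normr_ge0 x; have y0 := normr_ge0 y.
  rewrite (@le_trans _ _ (n%:R * `|x| * ((a + b) * `|y|)))//.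
    by rewrite ler_wpM2l// mulr_ge0.
  rewrite -subr_ge0.
  have -> : (1 + (n%:R + 1) * (a + b)) * `|x| * `|y| -
    n%:R * `|x| * ((a + b) * `|y|) = (1 + a + b) * (`|x| * `|y|) by ring.
  by rewrite !mulr_ge0// !addr_ge0.
split.
- by rewrite lerDl mulr_ge0 ?addr_ge0.
- move=> x y; apply: prod_le; rewrite (le_trans (aN y))// ler_wpM2r//.
  by rewrite lerDl.
- by move=> x y; exact: prod_le.
- move=> y; rewrite (le_trans (NPle y))// ler_wpM2r//.
  have : 0 <= n%:R * (a + b) by rewrite mulr_ge0// addr_ge0.
  by lra.
Qed.

(** On the ball of radius [2 r] the condition [16 c r <= 1] makes the quadratic
    map a perturbation of the identity by a [1/2]-Lipschitz map. *)
Section Radius.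
Variables (c r : R).
Hypothesis c1 : 1 <= c.
Hypothesis Nc : forall x y, `|x *m N y| <= c * `|x| * `|y|.
Hypothesis Sc : forall x y, `|x *m (N y + P y)| <= c * `|x| * `|y|.
Hypothesis Sc' : forall y, `|N y + P y| <= c * `|y|.
Hypothesis r0 : 0 < r.
Hypothesis cr : 16 * (c * r) <= 1.
Let c0 : 0 <= c := le_trans ler01 c1.

Lemma qmap_near_id h d : `|h| <= 2 * r -> `|h + d| <= 2 * r ->
  `|d *m (N h + P h) + d *m N d| <= 2^-1 * `|d|.
Proof.
move=> hr hdr.
have dr : `|d| <= 4 * r.
  have -> : d = (h + d) - h by rewrite addrC addKr.
  by rewrite (le_trans (ler_normB _ _))//; lra.
rewrite (le_trans (ler_normD _ _))//.
have d0 := normr_ge0 d; have h0 := normr_ge0 h.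
have := Sc d h; have := Nc d d.
have : c * `|d| * `|h| <= c * `|d| * (2 * r).
  by rewrite ler_wpM2l// mulr_ge0.
have : c * `|d| * `|d| <= c * `|d| * (4 * r).
  by rewrite ler_wpM2l// mulr_ge0.
have : 16 * (c * r) * `|d| <= 1 * `|d| by rewrite ler_wpM2r.
by lra.
Qed.

Lemma qmap_expand h h' : `|h| <= 2 * r -> `|h'| <= 2 * r ->
  `|h' - h| <= 2 * `|qmap h' - qmap h|.
Proof.
move=> hr h'r; set d := h' - h.
have h'E : h' = h + d by rewrite addrC subrK.
have := @qmap_near_id h d hr; rewrite -h'E => /(_ h'r) dle.
rewrite h'E qmapD /qdiff mulmxDr mulmx1.
set e := _ + _ in dle.
have -> : qmap h + (d + d *m (N h + P h)) + d *m N d - qmap h = d + e.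
  rewrite /e; move: (qmap h) (d *m _) (d *m _) => a b b'.
  by apply/matrixP => i j; rewrite !mxE; ring.
have := ler_normB (d + e) e; rewrite addrK.
by lra.
Qed.

(** The solution of [h + h N h = y] is the fixed point of [h |-> y - h N h],
    which contracts the closed ball of radius [2 r] into its interior. *)
Lemma qmap_surj y : `|y| < r -> exists2 h, `|h| < 2 * r & qmap h = y.
Proof.
move=> yr; pose U := [set h : 'rV[R]_n | `|h| <= 2 * r].
pose F h := y - h *m N h.
have FU' h : U h -> `|F h| < 2 * r.
  rewrite /U /= => hr; rewrite /F (le_lt_trans (ler_normB _ _))//.
  have h0 := normr_ge0 h; have := Nc h h.
  have : c * `|h| * `|h| <= c * (2 * r) * (2 * r).
    by apply: ler_pM => //; [exact: mulr_ge0|exact: ler_wpM2l].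
  have : 16 * (c * r) * r <= 1 * r by rewrite ler_wpM2r// ltW.
  by move: yr; lra.
have FU : set_fun U U F by move=> h Uh; apply/ltW/FU'.
have Fc : is_contraction (mkfun FU).
  exists (2^-1)%:nng; split=> /=; first by lra.
  move=> [a b] [/= Ua Ub]; rewrite /= /mkfun.
  have aE : a = b + (a - b) by rewrite addrC subrK.
  have := qmap_near_id (d := a - b) Ub; rewrite -aE => /(_ Ua).
  apply: le_trans; rewrite -normrN le_eqVlt; apply/orP/or_introl/eqP.
  congr (`| _ |); rewrite /F; have := qmapD b (a - b).
  rewrite -aE /qmap /qdiff mulmxDr mulmx1.
  move: (a *m _) (b *m _) ((a - b) *m _) ((a - b) *m _) => A B C D.
  move=> /matrixP E; apply/matrixP => i j.
  by have := E i j; rewrite !mxE; lra.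
have cU : closed U.
  have -> : U = Num.norm @^-1` [set t : R | t <= 2 * r] by [].
  apply: closed_comp; last exact: closed_le.
  by move=> x _; exact: norm_continuous.
have [|h Uh hF] := banach_fixed_point Fc cU.
  by exists 0; rewrite /U /= normr0 mulr_ge0// ltW.
exists h; last by rewrite /qmap {1}hF /mkfun /F /= subrK.
by rewrite hF; exact: FU'.
Qed.

Lemma qdiff_lower h k : `|h| <= 2 * r -> `|k| <= 2 * `|k *m qdiff h|.
Proof.
move=> hr; rewrite /qdiff mulmxDr mulmx1.
have := ler_normB (k + k *m (N h + P h)) (k *m (N h + P h)); rewrite addrK.
have k0 := normr_ge0 k; have := Sc k h.
have : c * `|k| * `|h| <= c * `|k| * (2 * r) by rewrite ler_wpM2l// mulr_ge0.
have : 16 * (c * r) * `|k| <= 1 * `|k| by rewrite ler_wpM2r.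
by lra.
Qed.

Lemma qdiff_unit h : `|h| <= 2 * r -> qdiff h \in unitmx.
Proof.
move=> hr; rewrite -row_free_unit; apply: inj_row_free => k k0.
apply/eqP; rewrite -normr_le0; have := qdiff_lower k hr.
by rewrite k0 normr0 mulr0.
Qed.

Lemma norm_invmx_qdiff h : `|h| <= 2 * r -> `|invmx (qdiff h)| <= 2.
Proof.
move=> hr; apply: mx_norm_le => // i j.
have -> : invmx (qdiff h) i j = row i (invmx (qdiff h)) 0 j by rewrite mxE.
rewrite (le_trans (ler_coord_norm _ _ _))// rowE.
rewrite (le_trans (qdiff_lower _ hr))// mulmxKV ?qdiff_unit//.
rewrite ger_pMr//; apply: mx_norm_le => // i' j'.
by rewrite mxE; case: (_ && _); rewrite ?normr1 ?normr0.
Qed.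

Definition qinv y := xget 0 [set h | `|h| < 2 * r /\ qmap h = y].

Lemma qinvP y : `|y| < r -> `|qinv y| < 2 * r /\ qmap (qinv y) = y.
Proof.
move=> /qmap_surj[h hr hy].
by apply: (@xgetPex _ 0 [set h | `|h| < 2 * r /\ qmap h = y]); exists h.
Qed.

Lemma qmapK h : `|h| < 2 * r -> `|qmap h| < r -> qinv (qmap h) = h.
Proof.
move=> hr /qinvP[gr gh]; apply/eqP; rewrite -subr_eq0 -normr_le0.
by rewrite (le_trans (qmap_expand (ltW hr) (ltW gr)))// gh subrr normr0 mulr0.
Qed.

Lemma qinv0 : qinv 0 = 0.
Proof. by rewrite -[in LHS]qmap0 qmapK ?qmap0 ?normr0 ?mulr_gt0. Qed.

Lemma qinv_lipschitz y y' : `|y| < r -> `|y'| < r ->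
  `|qinv y' - qinv y| <= 2 * `|y' - y|.
Proof.
move=> /qinvP[gr gy] /qinvP[gr' gy'].
by rewrite (le_trans (qmap_expand (ltW gr) (ltW gr')))// gy gy'.
Qed.

Lemma near_ball_shift y : `|y| < r -> \forall h \near (0 : 'rV[R]_n), `|h + y| < r.
Proof.
move=> yr; apply/nbhs_ballP; exists (r - `|y|); first by rewrite /= subr_gt0.
move=> h; rewrite -ball_normE /= sub0r normrN ltrBrDr => hr.
by rewrite (le_lt_trans (ler_normD _ _)).
Qed.

Lemma norm_mulmx_le2 m p q (A : 'M[R]_(m, p)) (B : 'M[R]_(p, q)) a b :
  `|A| <= a -> `|B| <= b -> `|A *m B| <= p%:R * a * b.
Proof.
move=> Aa Bb; rewrite (le_trans (norm_mulmx_le _ _))//.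
by rewrite -!mulrA ler_wpM2l// ler_pM.
Qed.

Definition qinv_diff y := invmx (qdiff (qinv y)).

Lemma qinv_remainder y h : `|y| < r -> `|h + y| < r ->
  `|qinv (h + y) - qinv y - h *m qinv_diff y| <= n%:R * (4 * c) * 2 * `|h| ^+ 2.
Proof.
move=> yr hyr; have [gr gy] := qinvP yr; have [gr' gy'] := qinvP hyr.
set d := qinv (h + y) - qinv y.
have dle : `|d| <= 2 * `|h|.
  by rewrite (le_trans (qinv_lipschitz yr hyr))// addrK.
have hE : h = d *m qdiff (qinv y) + d *m N d.
  have := qmapD (qinv y) d; rewrite {1}/d addrC subrK gy gy'.
  by rewrite -addrA [LHS]addrC => /addrI.
rewrite {1}hE mulmxDl (mulmxK (qdiff_unit (ltW gr))) opprD addrA subrr sub0r normrN.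
have := Nc d d => dd.
have B2 : `|qinv_diff y| <= 2 := norm_invmx_qdiff (ltW gr).
rewrite (le_trans (norm_mulmx_le2 dd B2))//.
have -> : n%:R * (4 * c) * 2 * `|h| ^+ 2 =
  n%:R * (c * (2 * `|h|) * (2 * `|h|)) * 2 by ring.
rewrite ler_wpM2r// ler_wpM2l//.
by apply: ler_pM => //; [exact: mulr_ge0|exact: ler_wpM2l].
Qed.

Lemma is_diff_qinv y : `|y| < r ->
  is_diff y qinv (fun v => v *m qinv_diff y).
Proof.
move=> yr; pose df := mulmxr (qinv_diff y) : {linear 'rV[R]_n -> 'rV[R]_n}.
apply: (@is_diff_quadratic_remainder _ _ _ _ df _ (n%:R * (4 * c) * 2)).
  exact: linear_rV_continuous.
by apply: filterS (near_ball_shift yr) => h; exact: qinv_remainder.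
Qed.

(** The derivative of [y |-> M(y)^-1] along [v] is [- M^-1 (D_v M) M^-1], and
    [D_v M] is the linear part of the derivative evaluated at the velocity
    [v M^-1] of the inverse map; the sign is absorbed in that argument. The
    proof uses the exact difference [B' - B = - B' (L d) B] twice. *)
Lemma is_diff_qinv_diff y : `|y| < r ->
  is_diff y qinv_diff (fun v => qinv_diff y *m
    (N (- (v *m qinv_diff y)) + P (- (v *m qinv_diff y))) *m qinv_diff y).
Proof.
move=> yr; set B := qinv_diff y.
pose df := (mulmxr B \o (mulmx B \o ((N \+ P) \o (-%R \o mulmxr B))))
  : {linear 'rV[R]_n -> 'M[R]_n}.
pose K := n%:R * (n%:R * (n%:R * (n%:R * 2 * (2 * c)) * 2) * (2 * c)) * 2
  + n%:R * (n%:R * 2 * (c * (n%:R * (4 * c) * 2))) * 2.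
apply: (@is_diff_quadratic_remainder _ _ _ _ df _ K).
  exact: linear_rV_continuous.
apply: filterS (near_ball_shift yr) => h hyr.
have [gr gy] := qinvP yr; have [gr' gy'] := qinvP hyr.
set d := qinv (h + y) - qinv y.
have dle : `|d| <= 2 * `|h|.
  by rewrite (le_trans (qinv_lipschitz yr hyr))// addrK.
set B' := qinv_diff (h + y).
pose L k := N k + P k.
have LD k k' : L (k - k') = L k - L k' by rewrite /L !linearB addrACA -opprD.
have Ld : `|L d| <= 2 * c * `|h|.
  by rewrite (le_trans (Sc' d))// [2 * c]mulrC -mulrA ler_wpM2l.
have BB : B' - B = - (B' *m L d *m B).
  have LdE : L d = qdiff (qinv (h + y)) - qdiff (qinv y).
    by rewrite LD /qdiff [in RHS]opprD [RHS]addrACA subrr add0r.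
  rewrite LdE mulmxBr mulmxBl (mulVmx (qdiff_unit (ltW gr'))) mul1mx.
  by rewrite (mulmxK (qdiff_unit (ltW gr))) opprB.
have -> : B' - B - df h = B' *m L d *m B *m L d *m B + B *m L (h *m B - d) *m B.
  have -> : df h = - (B *m L (h *m B) *m B).
    by rewrite /df /= /L !linearN /= -opprD mulmxN mulNmx.
  have -> : B' *m L d *m B = B - B' by rewrite -opprB BB opprK.
  rewrite (LD (h *m B) d) mulmxBr !mulmxBl BB.
  move: (B' *m L d *m B) (B *m L (h *m B) *m B) (B *m L d *m B) => a b e.
  by apply/matrixP => i j; rewrite !mxE; ring.
have B2 : `|B| <= 2 := norm_invmx_qdiff (ltW gr).
have B'2 : `|B'| <= 2 := norm_invmx_qdiff (ltW gr').
have Lr : `|L (h *m B - d)| <= c * (n%:R * (4 * c) * 2 * `|h| ^+ 2).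
  rewrite (le_trans (Sc' _))// ler_wpM2l// distrC.
  exact: qinv_remainder.
have := norm_mulmx_le2
  (norm_mulmx_le2 (norm_mulmx_le2 (norm_mulmx_le2 B'2 Ld) B2) Ld) B2.
have := norm_mulmx_le2 (norm_mulmx_le2 B2 Lr) B2.
move=> h2 h1; rewrite (le_trans (ler_normD _ _))//.
have -> : K * `|h| ^+ 2 =
  n%:R * (n%:R * (n%:R * (n%:R * 2 * (2 * c * `|h|)) * 2) * (2 * c * `|h|)) * 2
  + n%:R * (n%:R * 2 * (c * (n%:R * (4 * c) * 2 * `|h| ^+ 2))) * 2.
  by rewrite /K; ring.
by apply: lerD.
Qed.

Lemma open_norm_lt (V : normedModType R) e : open [set v : V | `|v| < e].
Proof.
have -> : [set v : V | `|v| < e] = Num.norm @^-1` [set t : R | t < e] by [].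
by apply: open_comp; [move=> x _; exact: norm_continuous|exact: open_lt].
Qed.

(** Both the inverse map [g] and its derivative [B] have directional derivatives
    that are products of constants, [B] and linear functions of [B]; hence if
    both are [C^k] then both are [C^(k+1)]. *)
Lemma smooth_qinv : smooth_on [set y | `|y| < r] qinv.
Proof.
set U := [set y | _]; have oU : open U := @open_norm_lt _ r.
suff C (j : nat) : Ck_on j U qinv /\ Ck_on j U qinv_diff by move=> j; have [] := C j.
elim: j => [|j [IHg IHB]].
  split=> y /= yr; apply: differentiable_continuous.
    by have [] := is_diff_qinv yr.
  by have [] := is_diff_qinv_diff yr.
split; split=> [y yr|v].
- by have [] := is_diff_qinv yr.
- apply: Ck_on_eq (Ck_on_mulmx oU (Ck_on_cst _ _ v) IHB) => // y yr.
  by rewrite (is_diff_derive v (is_diff_qinv yr)).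
- by have [] := is_diff_qinv_diff yr.
have vB : Ck_on j U (fun y => - (v *m qinv_diff y)).
  have -> : (fun y => - (v *m qinv_diff y)) = fun y => (- v) *m qinv_diff y.
    by rewrite funeqE => y; rewrite mulNmx.
  exact: Ck_on_mulmx oU (Ck_on_cst _ _ _) IHB.
have LvB := Ck_on_lin_comp (@linear_rV_continuous _ _ _ (N \+ P : {linear _ -> _})) oU vB.
apply: Ck_on_eq (Ck_on_mulmx oU (Ck_on_mulmx oU IHB LvB) IHB) => // y yr.
by rewrite (is_diff_derive v (is_diff_qinv_diff yr)).
Qed.

End Radius.
End QuadraticInverse.

Lemma mulmx_row_matrix (R : realType) n m (u : 'I_n -> 'rV[R]_m) (h : 'rV[R]_n) :
  h *m (\matrix_i u i) = \sum_i h 0 i *: u i.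
Proof. by rewrite mulmx_sum_row; apply: eq_bigr => i _; rewrite rowK. Qed.

Section QuadraticLocalInverse.
Variables (R : realType) (n : nat).
Variable b : {bilinear 'rV[R]_n -> 'rV[R]_n -> 'rV[R]_n}.

Let N k : 'M[R]_n := \matrix_i b (delta_mx 0 i) k.
Let P h : 'M[R]_n := \matrix_i b h (delta_mx 0 i).

Let N_linear : linear N.
Proof. by move=> c h k; apply/matrixP => i j; rewrite !mxE linearPr !mxE. Qed.
Let P_linear : linear P.
Proof. by move=> c h k; apply/matrixP => i j; rewrite !mxE linearPl !mxE. Qed.
HB.instance Definition _ := GRing.isLinear.Build R _ _ _ N N_linear.
HB.instance Definition _ := GRing.isLinear.Build R _ _ _ P P_linear.

Let NE h k : h *m N k = b h k.
Proof.
rewrite mulmx_row_matrix [in RHS](row_sum_delta h) linear_sumlz.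
by apply: eq_bigr => i _; rewrite linearZl_LR.
Qed.

Let PE h k : k *m P h = b h k.
Proof.
rewrite mulmx_row_matrix [in RHS](row_sum_delta k) linear_sumr.
by apply: eq_bigr => i _; rewrite linearZr_LR.
Qed.

Lemma smooth_quadratic (a : 'rV[R]_n) U :
  open U -> smooth_on U (fun z => (z - a) + b (z - a) (z - a)).
Proof.
move=> oU k.
have sub_smooth : Ck_on k U (fun z => z - a).
  apply: Ck_onD => //; last exact: Ck_on_cst.
  apply: (@Ck_on_lin _ _ _ _ _ (idfun : {linear 'rV[R]_n -> 'rV[R]_n})).
  exact: linear_rV_continuous.
apply: Ck_onD => //.
have -> : (fun z => b (z - a) (z - a)) = fun z => (z - a) *m N (z - a).
  by rewrite funeqE => z; rewrite NE.
apply: Ck_on_mulmx => //.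
exact: (Ck_on_lin_comp (@linear_rV_continuous _ _ _ N) oU sub_smooth).
Qed.

(** Inverse function theorem for a quadratic map tangent to the identity, with
    arbitrarily small radius. *)
Lemma quadratic_local_inverse (e : R) : 0 < e -> exists r (g : 'rV[R]_n -> 'rV[R]_n),
  [/\ 0 < r <= e, smooth_on [set y | `|y| < r] g,
      (g 0 = 0) /\ is_diff 0 g id &
   [/\ forall y, `|y| < r -> `|g y| < 2 * r /\ g y + b (g y) (g y) = y,
      forall h, `|h| < 2 * r -> `|h + b h h| < r -> g (h + b h h) = h &
      forall y y', `|y| < r -> `|y'| < r -> `|g y' - g y| <= 2 * `|y' - y| ] ].
Proof.
move=> e0; have [c [c1 Nc Sc Sc']] := qmap_bounds N P.
have c0 : 0 < c by apply: lt_le_trans c1.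
pose r := Num.min e (16 * c)^-1.
have r0 : 0 < r by rewrite lt_min e0 invr_gt0 mulr_gt0.
have cr : 16 * (c * r) <= 1.
  rewrite mulrA mulrC -ler_pdivlMr ?mulr_gt0// mul1r.
  by rewrite ge_min lexx orbT.
have NP h k : h *m N k = k *m P h by rewrite NE PE.
have qE h : qmap N h = h + b h h by rewrite /qmap NE.
have normr00 : `|0 : 'rV[R]_n| < r by rewrite normr0.
have g0 := qinv0 NP c1 Nc Sc r0 cr.
exists r, (qinv N r); split.
- by rewrite r0 ge_min lexx.
- exact: (smooth_qinv NP c1 Nc Sc Sc' r0 cr).
- split; first exact: g0.
  apply: is_diff_eq (is_diff_qinv NP c1 Nc Sc r0 cr normr00) _.
  rewrite funeqE => v; rewrite /qinv_diff g0 /qdiff !linear0 !addr0.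
  by rewrite invmx1 mulmx1.
- split.
  + by move=> y yr; rewrite -qE; exact: (qinvP NP c1 Nc Sc r0 cr yr).
  + by move=> h; rewrite -qE; exact: (qmapK NP c1 Nc Sc r0 cr).
  + by move=> y y'; exact: (qinv_lipschitz NP c1 Nc Sc r0 cr).
Qed.

End QuadraticLocalInverse.

(** * Norms on vector spaces and a Gronwall argument *)

Section VNorm.
Variable R : realType.
Implicit Types U V W : vectType R.

(** The norm that puts on [V] the topology of its coordinate space. *)
Definition vnorm V (v : V) : R := `|v2r v|.

Lemma vnorm_ge0 V (v : V) : 0 <= vnorm v. Proof. exact: normr_ge0. Qed.

Lemma vnorm0 V : vnorm (0 : V) = 0.
Proof. by rewrite /vnorm linear0 normr0. Qed.

Lemma vnormD V (u v : V) : vnorm (u + v) <= vnorm u + vnorm v.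
Proof. by rewrite /vnorm linearD ler_normD. Qed.

Lemma vnormN V (v : V) : vnorm (- v) = vnorm v.
Proof. by rewrite /vnorm linearN normrN. Qed.

Lemma vnormB V (u v : V) : vnorm (u - v) <= vnorm u + vnorm v.
Proof. by rewrite -(vnormN v) vnormD. Qed.

Lemma vnorm_eq0 V (v : V) : vnorm v <= 0 -> v = 0.
Proof.
by rewrite normr_le0 => /eqP e; rewrite -(v2rK v) e linear0.
Qed.

Lemma linear_vnorm V W (f : {linear V -> W}) :
  exists2 c, 0 <= c & forall v, vnorm (f v) <= c * vnorm v.
Proof.
have [c c0 fc] := linear_rV_bounded (v2r \o (f \o r2v)).
by exists c => // v; have := fc (v2r v); rewrite /= v2rK.
Qed.

Lemma bilinear_vnorm U V W (b : {bilinear U -> V -> W}) :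
  exists2 c, 0 <= c & forall u v, vnorm (b u v) <= c * vnorm u * vnorm v.
Proof.
pose e i : U := r2v (delta_mx 0 i).
have bc i : exists c, 0 <= c /\ forall v, vnorm (b (e i) v) <= c * vnorm v.
  by have [c ? ?] := linear_vnorm (b (e i)); exists c.
have [c cP] := choice bc.
exists (\sum_i c i); first by apply: sumr_ge0 => i _; have [] := cP i.
move=> u v; rewrite [in leLHS](vec_sum u) linear_sumlz.
rewrite -mulrA mulr_suml.
apply: (@le_trans _ _ (\sum_i vnorm (v2r u 0 i *: b (e i) v))).
  rewrite /vnorm linear_sum; under eq_bigr do rewrite linearZl_LR /=.
  exact: ler_norm_sum.
apply: ler_sum => i _; have [c0 ci] := cP i.
rewrite /vnorm linearZ normrZ mulrCA ler_pM//; first exact: ler_coord_norm.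
exact: ci.
Qed.

(** A left inverse of an injective linear map is again linear, hence bounded. *)
Lemma injective_vnorm V W (f : {linear V -> W}) : injective f ->
  exists2 c, 0 <= c & forall v, vnorm v <= c * vnorm (f v).
Proof.
move=> finj; have fK : lker (linfun f) == 0%VS.
  by apply/lker0P => u v; rewrite !lfunE; exact: finj.
have [c c0 fc] := linear_vnorm ((linfun f)^-1)%VF.
exists c => // v; have := fc (f v).
by rewrite -[in X in vnorm X](lfunE f) /= lker0_lfunK.
Qed.

(** A discrete Gronwall argument: if [phi 0 = 0] and [phi] grows over a time
    step [s] by at most [a s phi + k s^2] with [a <= 1/2], then cutting [[0, 1]]
    into [n] steps gives [phi (j / n) <= 2 j k / n^2] by induction on [j], hence
    [phi 1 <= 2 k / n] for every [n]. No derivative of [phi] is involved. *)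
Lemma discrete_gronwall (phi : R -> R) (a k : R) : 0 <= phi 1 ->
  phi 0 <= 0 -> 0 <= k -> a <= 2^-1 ->
  (forall t t', 0 <= t <= 1 -> 0 <= t' <= 1 -> t <= t' ->
     phi t' <= phi t + a * (t' - t) * phi t + k * (t' - t) ^+ 2) ->
  0 <= a -> phi 1 = 0.
Proof.
move=> phi1 phi0 k0 a2 step a0.
have bound n : (0 < n)%N -> phi 1 <= 2 * k / n%:R.
  move=> n0; have nR : 0 < n%:R :> R by rewrite ltr0n.
  have H j : (j <= n)%N -> phi (j%:R / n%:R) <= 2 * j%:R * (k / n%:R ^+ 2).
    elim: j => [|j IHj] jn; first by rewrite mul0r mulr0 mul0r.
    have jR : j.+1%:R = j%:R + 1 :> R by rewrite -addn1 natrD.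
    have j0 : 0 <= j%:R :> R by [].
    have jn' : j%:R + 1 <= n%:R :> R by rewrite -jR ler_nat.
    have dE : j.+1%:R / n%:R - j%:R / n%:R = n%:R^-1 :> R.
      by rewrite -mulrBl jR addrAC subrr add0r mul1r.
    have := step (j%:R / n%:R) (j.+1%:R / n%:R); rewrite dE => step'.
    rewrite (le_trans (step' _ _ _))//.
    - by rewrite divr_ge0//= ler_pdivrMr// mul1r ler_nat ltnW.
    - by rewrite divr_ge0//= ler_pdivrMr// mul1r ler_nat.
    - by rewrite ler_pM2r ?invr_gt0// ler_nat.
    have := IHj (ltnW jn); set f := phi _ => IH.
    set m := n%:R^-1.
    have m0 : 0 < m by rewrite invr_gt0.
    have am0 : 0 <= a * m by rewrite mulr_ge0// ltW.
    have : a * m * f <= a * m * (2 * j%:R * (k / n%:R ^+ 2)).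
      by rewrite ler_wpM2l.
    have -> : k / n%:R ^+ 2 = k * m ^+ 2 by rewrite exprVn.
    rewrite -exprVn -/m in IH.
    set K := k * m ^+ 2 in IH *.
    have K0 : 0 <= K by rewrite mulr_ge0// exprn_ge0// ltW.
    have : a * m * (2 * j%:R * K) <= 1 * K.
      have -> : a * m * (2 * j%:R * K) = (2 * a) * (m * j%:R) * K by ring.
      have m0' := ltW m0.
      rewrite ler_wpM2r// mulr_ile1 ?mulr_ge0//; first by lra.
      by rewrite mulrC ler_pdivrMr// mul1r; lra.
    by rewrite jR; move: IH; lra.
  have := H n (leqnn _); rewrite divff ?gt_eqF// => /le_trans; apply.
  by rewrite expr2 invfM mulrCA !mulrA mulrK ?unitfE ?gt_eqF//; lra.
apply/eqP; rewrite eq_le phi1 andbT leNgt; apply/negP => p0.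
have := archi_boundP (x := 2 * k / phi 1); rewrite divr_ge0 ?mulr_ge0// => /(_ isT).
set n := Num.bound _ => hn.
have := bound n.+1 isT; rewrite ler_pdivlMr// leNgt.
rewrite ltr_pdivrMr// in hn.
rewrite (lt_le_trans hn)// mulrC ler_wpM2l//.
by rewrite ler_nat.
Qed.

End VNorm.

(** * Zero sets of equivariant quadratic maps *)

Section QuadraticMap.
Variables (R : fieldType) (V W : vectType R).
Variables (l : {linear V -> W}) (q : {bilinear V -> V -> W}).

Definition qeval x := l x + q x x.
Definition qtangent x h := l h + (q x h + q h x).

Lemma qtangent_linear x : linear (qtangent x).
Proof.
move=> c h k; rewrite /qtangent linearP linearPr linearPl !scalerDr.
by rewrite [X in _ + X = _]addrACA [LHS]addrACA.
Qed.
HB.instance Definition _ x :=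
  GRing.isLinear.Build R V W _ (qtangent x) (qtangent_linear x).

Lemma qevalD x h : qeval (x + h) = qeval x + qtangent x h + q h h.
Proof.
rewrite /qeval /qtangent linearD linearDl !linearDr /=.
by rewrite !addrA (addrAC (l x)).
Qed.

End QuadraticMap.

Section QuadraticMapCalculus.
Variables (R : realType) (V W : vectType R).
Variables (l : {linear V -> W}) (q : {bilinear V -> V -> W}).
Local Notation qeval := (qeval l q).
Local Notation qtangent := (qtangent l q).

Lemma qeval_is_diff (x : V) :
  is_diff (v2r x) (v2r \o (qeval \o r2v)) (v2r \o (qtangent x \o r2v)).
Proof.
have [c c0 qc] := bilinear_vnorm q.
apply: (@is_diff_quadratic_remainder _ _ _ _
  (v2r \o (qtangent x \o r2v) : {linear _ -> _}) _ c).
  exact: linear_rV_continuous.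
apply/nbhs_ballP; exists 1 => //= h _.
have -> : r2v (h + v2r x) = x + r2v h by rewrite linearD /= v2rK addrC.
rewrite v2rK qevalD.
have -> : v2r (qeval x + qtangent x (r2v h) + q (r2v h) (r2v h)) -
    v2r (qeval x) - v2r (qtangent x (r2v h)) = v2r (q (r2v h) (r2v h)).
  rewrite -!linearB; congr v2r; move: (qeval x) (qtangent x _) => A B.
  by rewrite [A + B + _]addrC addrA [_ - A]addrAC !addrK.
by have := qc (r2v h) (r2v h); rewrite /vnorm r2vK -mulrA -expr2.
Qed.

Lemma qeval_zero_vclosed : vclosed [set x | qeval x = 0].
Proof.
have Fc : continuous (v2r \o (qeval \o r2v)).
  move=> y; rewrite -[y]r2vK; apply: differentiable_continuous.
  by have [] := qeval_is_diff (r2v y).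
rewrite /vclosed; have -> : r2v @^-1` [set x | qeval x = 0] =
    (Num.norm \o (v2r \o (qeval \o r2v))) @^-1` [set t : R | t <= 0].
  apply/seteqP; split=> y /=; first by move=> ->; rewrite linear0 normr0.
  exact: vnorm_eq0.
apply: closed_comp; last exact: closed_le.
move=> y _; apply: continuous_comp; first exact: Fc.
exact: norm_continuous.
Qed.

End QuadraticMapCalculus.

(** The zero set of a quadratic map [F] that satisfies an infinitesimal
    equivariance: [act x] identifies a fixed model of the tangent space with the
    one at [x], and in this frame [dF x] is a fixed linear map [K], transported
    by [L x], up to an error [S y (F x)] which vanishes on the zero
    set. In other words the rank of [dF] is constant along the zero set, with
    a control of the defect off it; this is what makes the zero set smooth. *)
Section ZeroSet.
Variables (R : realType) (V W : vectType R).
Variables (l : {linear V -> W}) (q : {bilinear V -> V -> W}).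
Local Notation F := (qeval l q).
Local Notation dF := (qtangent l q).
Variables (act : {bilinear V -> V -> V}) (L S : {bilinear V -> W -> W}).
Variable K : {linear V -> W}.
Hypothesis dF_act : forall x Y, dF x (act x Y) = L x (K Y) + S Y (F x).
Variable p : V.
Hypothesis Fp : F p = 0.
Hypothesis act_inj : injective (act p).
Hypothesis L_inj : injective (L p).

Let T : 'Hom(V, W) := linfun (dF p).
Let s : 'Hom(W, V) := (T^-1)%VF.
Let TsT h : T (s (T h)) = T h.
Proof. by have /lfunP/(_ h) := inv_lfun_def T; rewrite !comp_lfunE. Qed.

Lemma tangent_act Y : dF p (act p Y) = L p (K Y).
Proof. by rewrite dF_act Fp linear0r addr0. Qed.

(** [act p] carries [ker K] onto the kernel of [dF p], so that this dimension does
    not depend on [p]. *)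
Lemma dim_ker_tangent : \dim (lker T) = \dim (lker (linfun K)).
Proof.
pose A : 'End(V) := linfun (act p).
have A0 : lker A == 0%VS by apply/lker0P => u v; rewrite !lfunE; exact: act_inj.
have -> : lker T = (A @: lker (linfun K))%VS.
  apply/vspaceP => v; rewrite memv_ker lfunE; apply/eqP/idP.
    move=> Tv; have vE : v = A (A^-1%VF v) by rewrite lker0_lfunVK.
    rewrite vE memv_img// memv_ker lfunE; apply/eqP/L_inj.
    rewrite -tangent_act linear0r.
    by move: vE; rewrite [A _]lfunE /= => <-.
  move=> /memv_imgP[u]; rewrite memv_ker lfunE => /eqP Ku ->.
  by rewrite lfunE /= tangent_act Ku linear0r.
rewrite limg_dim_eq//.
by rewrite (eqP A0) capv0.
Qed.

(** Injectivity of [act x] is an open condition on [x], with a uniform bound. *)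
Lemma act_inj_near : exists e a, [/\ 0 < e, 0 <= a &
  forall x Y, vnorm (x - p) <= e -> vnorm Y <= a * vnorm (act x Y)].
Proof.
have [a a0 aP] := injective_vnorm act_inj.
have [c c0 cP] := bilinear_vnorm act.
pose e := (2 * (a * c + 1))^-1.
have ac : 0 <= a * c by rewrite mulr_ge0.
have e0 : 0 < e by rewrite invr_gt0; lra.
have ae : a * c * e <= 2^-1.
  by rewrite /e ler_pdivrMr; lra.
exists e, (2 * a); split => //; first by rewrite mulr_ge0.
move=> x Y xp; have Y0 := vnorm_ge0 Y.
have actE : act p Y = act x Y - act (x - p) Y.
  by rewrite linearBl opprB addrC subrK.
have h1 : vnorm (act p Y) <= vnorm (act x Y) + c * e * vnorm Y.
  rewrite actE (le_trans (vnormB _ _))// lerD// (le_trans (cP _ _))//.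
  by rewrite ler_wpM2r// ler_wpM2l.
have := aP Y; have : a * vnorm (act p Y) <= a * (vnorm (act x Y) + c * e * vnorm Y).
  by rewrite ler_wpM2l.
have : a * c * e * vnorm Y <= 2^-1 * vnorm Y by rewrite ler_wpM2r.
lra.
Qed.

(** Near [p], every [dF x d] is close to the image [T V] of the derivative at
    [p], with an error controlled by [F x]: write [d = act x Y] and compare with
    [w = T (act p Y) = L p (K Y)]. The condition [T (s w) = w] says that [w]
    lies in [T V]. *)
Lemma tangent_estimate : exists e C, [/\ 0 < e, 0 <= C &
  forall x d, vnorm (x - p) <= e -> exists2 w, T (s w) = w &
    vnorm (dF x d - w) <= C * (vnorm (x - p) * vnorm w + vnorm d * vnorm (F x))].
Proof.
have [e [a [e0 a0 aP]]] := act_inj_near.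
have [b b0 bP] := injective_vnorm L_inj.
have [cL cL0 cLP] := bilinear_vnorm L.
have [cS cS0 cSP] := bilinear_vnorm S.
exists e, (cL * b + cS * a); split=> //; first by rewrite addr_ge0// mulr_ge0.
move=> x d xp.
have ker0 : lker (linfun (act x)) == 0%VS.
  rewrite -subv0; apply/subvP => Y; rewrite memv_ker lfunE memv0 => /eqP Y0.
  apply/eqP/vnorm_eq0; have := aP x Y xp.
  by move: Y0 => /= ->; rewrite vnorm0 mulr0.
pose Y := ((linfun (act x))^-1)%VF d.
have dE : d = act x Y by rewrite -[act x Y]lfunE lker0_lfunVK.
exists (T (act p Y)); first exact: TsT.
have wE : T (act p Y) = L p (K Y) by rewrite lfunE /= tangent_act.
have -> : dF x d - T (act p Y) = L (x - p) (K Y) + S Y (F x).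
  by rewrite wE dE dF_act linearBl addrAC.
have Yd : vnorm Y <= a * vnorm d by rewrite dE; exact: aP.
have KY : vnorm (K Y) <= b * vnorm (T (act p Y)) by rewrite wE; exact: bP.
have n1 := vnorm_ge0 (x - p); have n2 := vnorm_ge0 (F x).
have n3 := vnorm_ge0 d; have n4 := vnorm_ge0 (T (act p Y)).
rewrite (le_trans (vnormD _ _))//.
apply: (@le_trans _ _ (cL * b * (vnorm (x - p) * vnorm (T (act p Y)))
  + cS * a * (vnorm d * vnorm (F x)))); last first.
  rewrite -subr_ge0.
  set u := vnorm (x - p) * _; set v := vnorm d * _.
  have -> : (cL * b + cS * a) * (u + v) - (cL * b * u + cS * a * v)
    = cL * b * v + cS * a * u by ring.
  by rewrite addr_ge0// !mulr_ge0.
apply: lerD.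
  rewrite (le_trans (cLP _ _))//.
  have -> : cL * b * (vnorm (x - p) * vnorm (T (act p Y)))
   = cL * vnorm (x - p) * (b * vnorm (T (act p Y))) by ring.
  by rewrite ler_wpM2l// mulr_ge0.
rewrite (le_trans (cSP _ _))//.
have -> : cS * a * (vnorm d * vnorm (F x)) = cS * (a * vnorm d) * vnorm (F x) by ring.
by rewrite ler_wpM2r// ler_wpM2l.
Qed.

(** If the component of [F] along [T V], read by the projector [T s], vanishes at
    both ends of a step [d], then [T s] almost kills [dF x d]; being almost in
    [T V], this vector is then small, namely [O(|d| |F x| + |d|^2)]. The factor
    [t + 1] below bounds [w] and [dF x d - w] together. *)
Lemma transversal_step : exists e C, [/\ 0 < e, 0 <= C &
  forall x d, vnorm (x - p) <= e -> T (s (F x)) = 0 -> T (s (F (x + d))) = 0 ->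
    vnorm (F (x + d)) <= vnorm (F x) + C * vnorm d * vnorm (F x) + C * vnorm d ^+ 2].
Proof.
have [e [C [e0 C0 wP]]] := tangent_estimate.
have [cq cq0 cqP] := bilinear_vnorm q.
have [t t0 tP] := linear_vnorm (T \o s)%VF.
pose e' := Num.min e (2 * ((t + 1) * C + 1))^-1.
have tC : 0 <= (t + 1) * C by rewrite mulr_ge0// addr_ge0.
have e'0 : 0 < e' by rewrite lt_min e0 invr_gt0; lra.
have te' : (t + 1) * C * e' <= 2^-1.
  apply: (@le_trans _ _ ((t + 1) * C * (2 * ((t + 1) * C + 1))^-1)).
    by rewrite ler_wpM2l// ge_min lexx orbT.
  by rewrite ler_pdivrMr; lra.
exists e', (2 * (t + 1) * (C + cq)); split => //.
  by rewrite !mulr_ge0// addr_ge0.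
move=> x d xp sFx sFxd.
have xe : vnorm (x - p) <= e by rewrite (le_trans xp)// ge_min lexx.
have [w ws wd] := wP x d xe.
have sdF : T (s (dF x d)) = - T (s (q d d)).
  have TsD u v : T (s (u + v)) = T (s u) + T (s v) by rewrite !linearD.
  move: sFxd; rewrite qevalD (TsD (F x + _)) (TsD (F x)) sFx add0r => /eqP.
  by rewrite addr_eq0 => /eqP.
have wE : w = - (T \o s)%VF (dF x d - w) - (T \o s)%VF (q d d).
  have TsB u v : T (s (u - v)) = T (s u) - T (s v) by rewrite !linearB.
  by rewrite !comp_lfunE TsB sdF ws opprB opprK addrK.
have w0 := vnorm_ge0 w; have d0 := vnorm_ge0 d; have F0 := vnorm_ge0 (F x).
have qd := cqP d d.
have w1 : vnorm w <= t * vnorm (dF x d - w) + t * (cq * vnorm d * vnorm d).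
  rewrite [X in vnorm X <= _]wE (le_trans (vnormB _ _))// vnormN.
  by rewrite lerD ?tP// (le_trans (tP _))// ler_wpM2l.
have w2 : C * (vnorm (x - p) * vnorm w) <= C * (e' * vnorm w).
  by rewrite ler_wpM2l// ler_wpM2r.
have w3 : vnorm (dF x d - w) <= C * (e' * vnorm w) + C * (vnorm d * vnorm (F x)).
  by rewrite (le_trans wd)// mulrDr lerD.
have w4 : (t + 1) * vnorm (dF x d - w) <=
    (t + 1) * (C * (e' * vnorm w) + C * (vnorm d * vnorm (F x))).
  by rewrite ler_wpM2l// addr_ge0.
have w5 : (t + 1) * C * e' * vnorm w <= 2^-1 * vnorm w by rewrite ler_wpM2r.
have w6 : vnorm (F (x + d)) <=
    vnorm (F x) + (vnorm (dF x d - w) + vnorm w) + cq * vnorm d * vnorm d.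
  rewrite qevalD (le_trans (vnormD _ _))// lerD// (le_trans (vnormD _ _))// lerD//.
  by have := vnormD (dF x d - w) w; rewrite subrK.
have w7 : 0 <= cq * (vnorm d * vnorm (F x)) by rewrite !mulr_ge0.
have w8 : 0 <= C * (vnorm d * vnorm d) by rewrite !mulr_ge0.
have w9 : 0 <= t * (cq * (vnorm d * vnorm (F x))) by rewrite !mulr_ge0.
have w10 : 0 <= t * (C * (vnorm d * vnorm d)) by rewrite !mulr_ge0.
have w11 : 0 <= cq * (vnorm d * vnorm d) by rewrite !mulr_ge0.
have w12 := vnorm_ge0 (dF x d - w).
have w13 : 0 <= t * (cq * (vnorm d * vnorm d)) by rewrite !mulr_ge0.
apply: (le_trans w6); rewrite expr2.
lra.
Qed.

(** The chart at [p] sends [p + h] to [h + s (q h h)]. Since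
    [F (p + h) = T h + q h h] and [T s T = T], applying [T] to the chart yields
    [T s F], so that points of the zero set have coordinate in [ker T]. *)
Let b (h k : 'rV[R]_(dim V)) : 'rV[R]_(dim V) := v2r (s (q (r2v h) (r2v k))).
Let b_bilinear : bilinear_for
  (GRing.Scale.Law.clone _ _ *:%R _) (GRing.Scale.Law.clone _ _ *:%R _) b.
Proof.
split=> [k c h h'|h c k k'].
  by rewrite /b linearP linearPl /= linearP linearP.
by rewrite /b linearP linearPr /= linearP linearP.
Qed.
HB.instance Definition _ := bilinear_isBilinear.Build R _ _ _ _ _ b b_bilinear.

(** The points with chart coordinate in [ker T] are those where [T s F] vanishes.
    Along the segment from [0] to such a coordinate, the norm of [F] satisfies
    the hypotheses of the Gronwall argument, and it starts at [F p = 0]. *)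
Lemma zero_set_of_tangent_coordinate (r : R) (g : 'rV[R]_(dim V) -> 'rV[R]_(dim V))
    (e C : R) : 0 < r -> 2 * r <= e -> 0 <= C -> 2 * C * r <= 2^-1 ->
  (forall x d, vnorm (x - p) <= e -> T (s (F x)) = 0 -> T (s (F (x + d))) = 0 ->
    vnorm (F (x + d)) <=
      vnorm (F x) + C * vnorm d * vnorm (F x) + C * vnorm d ^+ 2) ->
  g 0 = 0 ->
  (forall y, `|y| < r -> `|g y| < 2 * r /\ g y + b (g y) (g y) = y) ->
  (forall y y', `|y| < r -> `|y'| < r -> `|g y' - g y| <= 2 * `|y' - y|) ->
  forall y, `|y| < r -> r2v y \in lker T -> F (p + r2v (g y)) = 0.
Proof.
move=> r0 re C0 Cr step g0 gP glip y yr; have r0' := ltW r0; rewrite memv_ker => /eqP Ty.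
pose x t : V := p + r2v (g (t *: y)).
have tyr t : 0 <= t <= 1 -> `|t *: y| < r.
  move=> /andP[t0 t1]; rewrite normrZ ger0_norm//.
  by rewrite (le_lt_trans _ yr)// ler_piMl.
have xp t : 0 <= t <= 1 -> vnorm (x t - p) <= e.
  move=> /tyr /gP[gr _]; rewrite /x addrC addKr /vnorm r2vK.
  by rewrite (le_trans (ltW gr)).
have sFx t : 0 <= t <= 1 -> T (s (F (x t))) = 0.
  move=> /tyr /gP[_ gE].
  have TsD u v : T (s (u + v)) = T (s u) + T (s v) by rewrite !linearD.
  set h := r2v (g (t *: y)) : V.
  have dT : dF p h = T h by rewrite lfunE.
  rewrite /x -/h qevalD Fp add0r TsD dT TsT -linearD.
  have -> : h + s (q h h) = t *: r2v y.
    by rewrite -linearZ -[in RHS]gE linearD /= /b v2rK.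
  by rewrite linearZ /= Ty scaler0.
pose phi t := vnorm (F (x t)).
suff : phi 1 = 0.
  rewrite /phi /x scale1r => F0.
  by apply: vnorm_eq0; rewrite F0.
apply: (@discrete_gronwall _ phi (2 * C * r) (4 * C * r ^+ 2)) => //.
- exact: vnorm_ge0.
- by rewrite /phi /x scale0r g0 linear0 addr0 Fp vnorm0.
- by rewrite !mulr_ge0.
- move=> t t' t01 t'01 tt'; pose d := x t' - x t.
  have x'E : x t' = x t + d by rewrite addrC subrK.
  have dle : vnorm d <= 2 * ((t' - t) * r).
    rewrite /d /x opprD addrACA subrr add0r -linearB /vnorm r2vK.
    rewrite (le_trans (glip _ _ (tyr _ t01) (tyr _ t'01)))// -scalerBl normrZ.
    have tt0 : 0 <= t' - t by rewrite subr_ge0.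
    by rewrite ger0_norm// ler_wpM2l// ler_wpM2l// ltW.
  have d0 := vnorm_ge0 d.
  have := step (x t) d (xp _ t01) (sFx _ t01); rewrite -x'E => /(_ (sFx _ t'01)).
  move/le_trans; apply; rewrite -/(phi t) -/(phi t').
  have p0 : 0 <= phi t := vnorm_ge0 _.
  have h1 : C * vnorm d * phi t <= C * (2 * ((t' - t) * r)) * phi t.
    by rewrite ler_wpM2r// ler_wpM2l.
  have h2 : C * vnorm d ^+ 2 <= C * (2 * ((t' - t) * r)) ^+ 2.
    by rewrite ler_wpM2l// !expr2 ler_pM.
  rewrite -!addrA lerD// (le_trans (lerD h1 h2))//.
  by rewrite le_eqVlt; apply/orP; left; apply/eqP; ring.
- by rewrite !mulr_ge0.
Qed.

Lemma zero_set_local_inverse : exists (r : R) (g : 'rV[R]_(dim V) -> 'rV[R]_(dim V)),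
  [/\ 0 < r, smooth_on [set y | `|y| < r] g,
     (g 0 = 0) /\ is_diff (0 : 'rV[R]_(dim V)) g id &
  [/\ forall y, `|y| < r -> `|g y| < 2 * r /\ g y + b (g y) (g y) = y,
      forall h, `|h| < 2 * r -> `|h + b h h| < r -> g (h + b h h) = h,
      forall y, `|y| < r -> r2v y \in lker T -> F (p + r2v (g y)) = 0 &
      forall x, vnorm (x - p) < 2 * r -> injective (act x)] ].
Proof.
have [e1 [a [e10 a0 actP]]] := act_inj_near.
have [e2 [C [e20 C0 step]]] := transversal_step.
pose e := Num.min (Num.min (e1 / 2) (e2 / 2)) (4 * (C + 1))^-1.
have C10 : 0 < 4 * (C + 1) by lra.
have e0 : 0 < e by rewrite !lt_min !divr_gt0//= invr_gt0.
have [r [g [/andP[r0 re] gs [g0 gd] [gP gK glip]]]] := quadratic_local_inverse b e0.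
have [re1 re2 rC] : [/\ r <= e1 / 2, r <= e2 / 2 & r <= (4 * (C + 1))^-1].
  by move: re; rewrite !le_min => /andP[/andP[]].
exists r, g; split=> //; split=> //.
- apply: (@zero_set_of_tangent_coordinate r g e2 C) => //.
    by lra.
  move: rC; rewrite -[(4 * _)^-1]mul1r ler_pdivlMr//.
  by lra.
- move=> x xr Y Y' YY'; have /(actP x (Y - Y')) : vnorm (x - p) <= e1 by lra.
  rewrite linearBr YY' subrr vnorm0 mulr0 => /vnorm_eq0 /eqP.
  by rewrite subr_eq0 => /eqP.
Qed.

Lemma zero_set_chart : exists (U U' : set V) (f g : V -> V),
  [/\ [/\ vopen U, vopen U' & U p],
      [/\ vsmooth_on U f, vsmooth_on U' g, f @` U = U' &
          forall x, U x -> g (f x) = x],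
      forall x, U x -> injective (act x) &
      forall x, U x -> (F x = 0 <-> f x \in lker T)].
Proof.
have [r [g [r0 gs [g0 _] [gP gK gZ gact]]]] := zero_set_local_inverse.
pose qm h := h + b h h.
pose f x : V := r2v (qm (v2r x - v2r p)).
pose U := [set x : V | `|v2r x - v2r p| < 2 * r /\ `|qm (v2r x - v2r p)| < r].
pose U' := [set y : V | `|v2r y| < r].
have qms k O : open O -> Ck_on k O (fun z => qm (z - v2r p)).
  by move=> oO; exact: smooth_quadratic.
have vU' : r2v @^-1` U' = [set y | `|y| < r].
  by apply/seteqP; split=> y /=; rewrite /U' /= r2vK.
have oU : vopen U.
  rewrite /vopen; have -> : r2v @^-1` U =
      (fun z => z - v2r p) @^-1` [set h | `|h| < 2 * r]
      `&` (fun z => qm (z - v2r p)) @^-1` [set h | `|h| < r].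
    by apply/seteqP; split=> y /=; rewrite /U /= r2vK.
  apply: openI; apply: open_comp; try exact: open_norm_lt.
    by move=> x _; apply: continuousB; [exact: cvg_id|exact: cst_continuous].
  by move=> x _; apply: (Ck_on_continuous (qms 0%N setT openT)).
have gf x : U x -> p + r2v (g (v2r (f x))) = x.
  move=> [xr qr]; rewrite /f r2vK gK// linearB /= !v2rK addrC subrK //.
exists U, U', f, (fun y => p + r2v (g (v2r y))); split.
- split => //; first by rewrite /vopen vU'; exact: open_norm_lt.
  by rewrite /U /= subrr /qm linear0l addr0 normr0 mulr_gt0.
- split => //.
  + move=> k; have -> : (fun x => v2r (f (r2v x))) = fun z => qm (z - v2r p).
      by rewrite funeqE => z; rewrite /f !r2vK.
    exact: qms.
  + rewrite /vsmooth_on vU' => k.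
    have -> : (fun x => v2r (p + r2v (g (v2r (r2v x : V))))) = cst (v2r p) \+ g.
      by rewrite funeqE => z; rewrite linearD /= !r2vK.
    by apply: Ck_onD; [exact: open_norm_lt|exact: Ck_on_cst|exact: gs].
  + apply/seteqP; split=> [_ [x [_ xr] <-]|y yr]; first by rewrite /U' /f /= r2vK.
    have [gr gE] := gP _ yr.
    have xE : v2r (p + r2v (g (v2r y))) - v2r p = g (v2r y).
      by rewrite linearD /= r2vK addrC addKr.
    exists (p + r2v (g (v2r y))); rewrite /U /f /= xE /qm gE //.
    by rewrite v2rK.
- by move=> x [xr _]; apply: gact; rewrite /vnorm linearB.
- move=> x Ux; split=> [Fx|fx].
  + rewrite memv_ker; apply/eqP.
    pose h := x - p; have xE : x = p + h by rewrite addrC subrK.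
    have dT : dF p h = T h by rewrite lfunE.
    have TsD u v : T (s (u + v)) = T (s u) + T (s v) by rewrite !linearD.
    have := Fx; rewrite {1}xE qevalD Fp add0r dT => Fh.
    rewrite /f /qm -linearB -/h linearD /= v2rK /b /= !v2rK linearD /=.
    by rewrite -TsT -TsD Fh !linear0.
  + rewrite -(gf x Ux); apply: gZ; last by rewrite v2rK.
    by case: Ux => _; rewrite /f r2vK.
Qed.

(** The image of the line [t X] under the inverse chart, whose derivative at [0] is
    the identity. *)
Lemma zero_set_curve X : T X = 0 -> exists (e : R) (c : R -> V),
  [/\ 0 < e, smooth_on `]-e, e[%classic (v2r \o c),
      (forall t, t \in `]-e, e[%R -> F (c t) = 0 /\ injective (act (c t))),
      c 0 = p & 'D_1 (v2r \o c) 0 = v2r X].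
Proof.
move=> TX.
have [r [g [r0 gs [g0 gd] [gP gK gZ gact]]]] := zero_set_local_inverse.
pose e := r / (vnorm X + 1).
have X0 := vnorm_ge0 X.
have e0 : 0 < e by rewrite divr_gt0//; lra.
pose lX := ( *:%R ^~ (v2r X)) : R -> 'rV[R]_(dim V).
have lXr t : t \in `]-e, e[%R -> `|lX t| < r.
  rewrite in_itv /= -ltr_norml /e ltr_pdivlMr; last lra.
  rewrite /lX normrZ; apply: le_lt_trans; rewrite ler_wpM2l//.
  by rewrite /vnorm; lra.
have lXlin : linear lX.
  by move=> a u v; rewrite /lX scalerDl scalerA.
pose lXL : {linear R -> 'rV[R]_(dim V)} :=
  HB.pack lX (GRing.isLinear.Build R _ _ _ lX lXlin).
have lXc : continuous lXL.
  by move=> t; exact: scalel_continuous.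
exists e, (fun t => p + r2v (g (lX t))); split => //.
- have -> : v2r \o (fun t => p + r2v (g (lX t))) = cst (v2r p) \+ (g \o lXL).
    by rewrite funeqE => t; rewrite /= linearD /= r2vK.
  move=> k; apply: Ck_onD; [exact: itv_open|exact: Ck_on_cst|].
  apply: Ck_on_sub (Ck_on_comp_lin lXc (@open_norm_lt _ _ r) (gs k)).
  by move=> t /= te; apply: lXr.
- move=> t /lXr tr; have [gr _] := gP _ tr; split.
    by apply: gZ => //; rewrite memv_ker /lX linearZ /= v2rK linearZ /= TX scaler0.
  by apply: gact; rewrite addrC addKr /vnorm r2vK.
- by rewrite /lX scale0r g0 linear0 addr0.
- have -> : v2r \o (fun t => p + r2v (g (lX t))) = cst (v2r p) + (g \o lXL).
    by rewrite funeqE => t; rewrite /= linearD /= r2vK.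
  have lX0 : lXL 0 = 0 by rewrite linear0.
  have dl : differentiable lXL (0 : R) by exact: linear_differentiable.
  rewrite -lX0 in gd.
  have d1 := is_diff_comp (differentiableP dl) gd.
  have d2 := is_diffD (is_diff_cst (v2r p) (0 : R)) d1.
  rewrite (is_diff_derive (1 : R) d2).
  rewrite -[LHS]/(0 + 'd lXL (0 : R) 1) add0r.
  have -> : 'd lXL (0 : R) = lXL :> (R -> _) by exact: diff_lin.
  by rewrite /= /lX scale1r.
Qed.

Lemma zero_set_curve_tangent (e : R) (c : R -> V) X : 0 < e ->
  differentiable (v2r \o c) (0 : R) ->
  (forall t, t \in `]-e, e[%R -> F (c t) = 0) -> c 0 = p ->
  'D_1 (v2r \o c) 0 = v2r X -> T X = 0.
Proof.
move=> e0 dc Fc cp cX.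
have dF0 := @qeval_is_diff _ _ _ l q (c 0).
have dFc := is_diff_comp (differentiableP dc) dF0.
have := is_diff_derive (1 : R) dFc.
have -> : 'D_1 ((v2r \o (F \o r2v)) \o (v2r \o c)) 0 = 0.
  rewrite -[RHS](derive_cst (0 : 'rV[R]_(dim W)) (0 : R) 1).
  apply: near_eq_derive; near=> t; rewrite /= v2rK Fc ?linear0//.
  near: t.
  have := near_in_itvoo (a := - e) (b := e) (x := 0).
  by apply; rewrite in_itv /= oppr_lt0 e0.
move=> /esym; rewrite /= -deriveE// cX v2rK cp => TX.
by rewrite lfunE /=; apply: v2r_inj; rewrite TX linear0.
Unshelve. all: by end_near. Qed.

End ZeroSet.

(** * The equations of coherent automorphisms and derivations *)

(** Identities between linear combinations in a vector space reduce, one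
    coordinate at a time, to ring identities in the base field. *)
Lemma linear_form_ext (F : fieldType) (V : vectType F) (u v : V) :
  (forall f : V -> F, {morph f : x y / x + y} -> {morph f : x / - x} ->
    (forall c x, f (c *: x) = c * f x) -> f 0 = 0 -> f u = f v) -> u = v.
Proof.
move=> fuv; apply: v2r_inj; apply/rowP => i.
by apply: (fuv (fun w => v2r w 0 i)) => [x y|x|c x|];
  rewrite ?(linearD, linearN, linearZ, linear0) mxE.
Qed.

Ltac lmod_ring :=
  apply: linear_form_ext; let f := fresh "f" in
  let fD := fresh in let fN := fresh in let fZ := fresh in let f0 := fresh in
  move=> f fD fN fZ f0; rewrite ?(fD, fN, fZ, f0); clear fD fN fZ f0;
  repeat match goal with |- context [f ?t] => generalize (f t) end;
  intros; ring.

(* Composition and tensor product of linear maps are sealed so that unification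
   treats them as atoms of the identities between sums of composites. *)
HB.lock Definition lcomp (F : fieldType) (U V W : vectType F)
  (f : 'Hom(V, W)) (g : 'Hom(U, V)) : 'Hom(U, W) := (f \o g)%VF.

HB.lock Definition ltens (F : fieldType) (A : vectType F) (f g : 'End(A)) :
  'End(tensor A A) := linfun (tlift (fun v w => tens (f v) (g w))).

Arguments lcomp {F U V W} f g.
Arguments ltens {F A} f g.

Section LfunBilinear.
Variable F : fieldType.

Lemma lcomp_bilinear U V W : bilinear_for
  (GRing.Scale.Law.clone _ _ *:%R _) (GRing.Scale.Law.clone _ _ *:%R _)
  (@lcomp F U V W).
Proof.
split=> [g c f f'|f c g g'].
  by rewrite /= lcomp.unlock comp_lfunDl -comp_lfunZl.
  by rewrite /= lcomp.unlock comp_lfunDr -comp_lfunZr.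
Qed.
HB.instance Definition _ (U V W : vectType F) := bilinear_isBilinear.Build F
  'Hom(V, W) 'Hom(U, V) 'Hom(U, W) _ _ (@lcomp F U V W) (@lcomp_bilinear U V W).

Lemma tens_lfun_ext (U V W : vectType F) (f g : 'Hom(tensor U V, W)) :
  (forall u v, f (tens u v) = g (tens u v)) -> f = g.
Proof. by move=> fg; apply/lfunP; exact: tensor_ext. Qed.

Lemma lcompPl (U V W : vectType F) c (f f' : 'Hom(V, W)) (g : 'Hom(U, V)) :
  lcomp (c *: f + f') g = c *: lcomp f g + lcomp f' g.
Proof. exact: linearPl. Qed.

Lemma lcompPr (U V W : vectType F) c (f : 'Hom(V, W)) (g g' : 'Hom(U, V)) :
  lcomp f (c *: g + g') = c *: lcomp f g + lcomp f g'.
Proof. exact: linearPr. Qed.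

Lemma lcompDl (U V W : vectType F) (f f' : 'Hom(V, W)) (g : 'Hom(U, V)) :
  lcomp (f + f') g = lcomp f g + lcomp f' g.
Proof. exact: linearDl. Qed.

Lemma lcompDr (U V W : vectType F) (f : 'Hom(V, W)) (g g' : 'Hom(U, V)) :
  lcomp f (g + g') = lcomp f g + lcomp f g'.
Proof. exact: linearDr. Qed.

Lemma lcompNl (U V W : vectType F) (f : 'Hom(V, W)) (g : 'Hom(U, V)) :
  lcomp (- f) g = - lcomp f g.
Proof. exact: linearNl. Qed.

Lemma lcompNr (U V W : vectType F) (f : 'Hom(V, W)) (g : 'Hom(U, V)) :
  lcomp f (- g) = - lcomp f g.
Proof. exact: linearNr. Qed.

Lemma lcompA (T U V W : vectType F) (f : 'Hom(V, W)) (g : 'Hom(U, V))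
  (h : 'Hom(T, U)) : lcomp f (lcomp g h) = lcomp (lcomp f g) h.
Proof. by rewrite !lcomp.unlock comp_lfunA. Qed.

(** If [c] intertwines [a] with [b] and [a'] with [b'], it intertwines the
    commutators: this one remark makes the coherent derivations a Lie algebra. *)
Lemma lcompBr_intertwine (V W : vectType F) (c : 'Hom(V, W)) (a a' : 'End(W))
    (b b' : 'End(V)) :
  lcomp a c = lcomp c b -> lcomp a' c = lcomp c b' ->
  lcomp (lcomp a a' - lcomp a' a) c = lcomp c (lcomp b b' - lcomp b' b).
Proof.
move=> e e'; rewrite lcompDl lcompDr lcompNl lcompNr.
by rewrite -!lcompA e e' !lcompA e e'.
Qed.

Lemma lcompE (U V W : vectType F) (f : 'Hom(V, W)) (g : 'Hom(U, V)) u :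
  lcomp f g u = f (g u).
Proof. by rewrite lcomp.unlock comp_lfunE. Qed.

Lemma lcomp1l (U V : vectType F) (f : 'Hom(U, V)) : lcomp \1%VF f = f.
Proof. by rewrite lcomp.unlock comp_lfun1l. Qed.

Lemma lcomp1r (U V : vectType F) (f : 'Hom(U, V)) : lcomp f \1%VF = f.
Proof. by rewrite lcomp.unlock comp_lfun1r. Qed.

Variable A : vectType F.
Implicit Types f g : 'End(A).

Lemma ltensE f g t : ltens f g t = tmap f g t.
Proof. by rewrite ltens.unlock lfunE. Qed.

Lemma ltens_tens f g v w : ltens f g (tens v w) = tens (f v) (g w).
Proof. by rewrite ltensE tmapE. Qed.

Lemma ltens_bilinear : bilinear_for
  (GRing.Scale.Law.clone _ _ *:%R _) (GRing.Scale.Law.clone _ _ *:%R _)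
  (@ltens F A).
Proof.
split=> [g c f f'|f c g g']; apply: tens_lfun_ext => u v;
  rewrite /= add_lfunE scale_lfunE !ltens_tens add_lfunE scale_lfunE.
  exact: tens_linearl.
exact: tens_linearr.
Qed.
HB.instance Definition _ := bilinear_isBilinear.Build F _ _ _ _ _
  (@ltens F A) ltens_bilinear.

Lemma ltensPl c f f' g : ltens (c *: f + f') g = c *: ltens f g + ltens f' g.
Proof. exact: linearPl. Qed.

Lemma ltensPr c f g g' : ltens f (c *: g + g') = c *: ltens f g + ltens f g'.
Proof. exact: linearPr. Qed.

Lemma ltensDl f f' g : ltens (f + f') g = ltens f g + ltens f' g.
Proof. exact: linearDl. Qed.

Lemma ltensDr f g g' : ltens f (g + g') = ltens f g + ltens f g'.
Proof. exact: linearDr. Qed.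

Lemma ltensNl f g : ltens (- f) g = - ltens f g.
Proof. exact: linearNl. Qed.

Lemma ltensNr f g : ltens f (- g) = - ltens f g.
Proof. exact: linearNr. Qed.

Lemma ltens_comp f g f' g' :
  lcomp (ltens f g) (ltens f' g') = ltens (lcomp f f') (lcomp g g').
Proof.
by apply: tens_lfun_ext => u v; rewrite lcompE !ltens_tens !lcompE.
Qed.

Lemma ltens_compA (W : vectType F) (h : 'Hom(tensor A A, W)) f g f' g' :
  lcomp (lcomp h (ltens f g)) (ltens f' g')
    = lcomp h (ltens (lcomp f f') (lcomp g g')).
Proof. by rewrite -lcompA ltens_comp. Qed.

Lemma ltens1lE f t : ltens \1 f t = tmap id f t.
Proof.
rewrite ltensE; congr (tmap _ _ _).
by rewrite funeqE => v; rewrite id_lfunE.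
Qed.

Lemma ltens1rE f t : ltens f \1 t = tmap f id t.
Proof.
rewrite ltensE; congr (tmap _ _ _).
by rewrite funeqE => v; rewrite id_lfunE.
Qed.

Lemma ltens11 : ltens \1 \1 = \1%VF :> 'End(tensor A A).
Proof. by apply: tens_lfun_ext => u v; rewrite ltens_tens !id_lfunE. Qed.

Lemma lfun_left_inverse f g : lcomp f g = \1%VF -> lcomp g f = \1%VF.
Proof.
rewrite lcomp.unlock => fg; have g0 : lker g == 0%VS.
  rewrite -subv0; apply/subvP => v; rewrite memv_ker memv0 => /eqP gv.
  by rewrite -[v]id_lfunE -fg comp_lfunE gv linear0.
have fE : f = (g^-1)%VF by rewrite -[f](lker0_compfK g0) fg comp_lfun1l.
by rewrite fE lker0_compfV.
Qed.

Lemma lfun_bij_comp f g : lcomp g f = \1%VF -> bijective f.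
Proof.
move=> gf; have fg := lfun_left_inverse gf.
by exists g => v; rewrite -lcompE ?gf ?fg id_lfunE.
Qed.

Lemma lfun_bij_inv f : bijective f ->
  lcomp f^-1%VF f = \1%VF /\ lcomp f f^-1%VF = \1%VF.
Proof.
move=> /bij_inj/lker0P f0; rewrite lcomp.unlock.
by split; [exact: lker0_compVf|exact: lker0_compfV].
Qed.

Lemma lcomp_inv_lfun f : lcomp (lcomp f f^-1%VF) f = f.
Proof. by rewrite lcomp.unlock inv_lfun_def. Qed.

End LfunBilinear.

Local Notation "f ∘ g" := (lcomp f g) (at level 45, left associativity).
Local Notation "f ⊠ g" := (ltens f g) (at level 40).

Section Coherent.
Variables (F : fieldType) (A : vectType F) (B : asiBialgebra A).

Local Notation Pairs := ('End(A) * 'End(A))%type.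
Local Notation Mul := 'Hom(tensor A A, A).
Local Notation Com := 'Hom(A, tensor A A).
(** The target of the coherence equations: the three of them that involve the
    product take values in [Hom(A ⊗ A, A)], the three that involve the coproduct
    in [Hom(A, A ⊗ A)]. *)
Definition coherence_space : vectType F :=
  (Mul * Com * Mul * Mul * Com * Com)%type.
Local Notation one := (\1%VF : 'End(A)).

Definition lmul : Mul := linfun (tlift (amul B)).
Local Notation μ := lmul.
Local Notation Δ := (comul B).

Lemma lmulE a b : μ (tens a b) = amul B a b.
Proof.
rewrite lfunE /= tliftE // => [w|v] c x y; first by rewrite linearPl.
by rewrite linearPr.
Qed.

(** [coh_lin x + coh_bil x x] collects the differences of the two sides of the
    six equations of a coherent automorphism; each is a polynomial of degree at
    most two in the pair. *)
Definition coh_lin (x : Pairs) : coherence_space :=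
  (x.1 ∘ μ, - (Δ ∘ x.2), - (μ ∘ (one ⊠ x.2)), - (μ ∘ (x.2 ⊠ one)),
   (one ⊠ x.1) ∘ Δ, (x.1 ⊠ one) ∘ Δ).

Definition coh_bil (x y : Pairs) : coherence_space :=
  (- (μ ∘ (x.1 ⊠ y.1)), (x.2 ⊠ y.2) ∘ Δ, x.2 ∘ μ ∘ (y.1 ⊠ one),
   x.2 ∘ μ ∘ (one ⊠ y.1), - ((x.2 ⊠ one) ∘ Δ ∘ y.1),
   - ((one ⊠ x.2) ∘ Δ ∘ y.1)).

(** Right translation by [x] in the group with opposite first factor:
    [(φ, ψ), (X, Z) |-> (φ X, Z ψ)]. *)
Definition coh_act (x y : Pairs) : Pairs := (x.1 ∘ y.1, y.2 ∘ x.2).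

(** The derivative of the six equations at the identity. *)
Definition coh_der (y : Pairs) : coherence_space :=
  (y.1 ∘ μ - (μ ∘ (y.1 ⊠ one) + μ ∘ (one ⊠ y.1)),
   (y.2 ⊠ one) ∘ Δ + (one ⊠ y.2) ∘ Δ - Δ ∘ y.2,
   μ ∘ (y.1 ⊠ one) + y.2 ∘ μ - μ ∘ (one ⊠ y.2),
   μ ∘ (one ⊠ y.1) + y.2 ∘ μ - μ ∘ (y.2 ⊠ one),
   (one ⊠ y.1) ∘ Δ - (y.2 ⊠ one) ∘ Δ - Δ ∘ y.1,
   (y.1 ⊠ one) ∘ Δ - (one ⊠ y.2) ∘ Δ - Δ ∘ y.1).

(** How each equation is transported from the identity to [x], and the error made
    when [x] is not a solution. Each is read off from the Leibniz rule: for the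
    first equation, [φ X μ - μ (φ X ⊗ φ) - μ (φ ⊗ φ X)] equals
    [φ (X μ - μ (X ⊗ 1 + 1 ⊗ X)) + (φ μ - μ (φ ⊗ φ)) (X ⊗ 1 + 1 ⊗ X)]. *)
Definition coh_L (x : Pairs) (n : coherence_space) : coherence_space :=
  let: (n1, n2, n3, n4, n5, n6) := n in
  (x.1 ∘ n1, n2 ∘ x.2, n3 ∘ (one ⊠ x.2), n4 ∘ (x.2 ⊠ one),
   (one ⊠ x.1) ∘ n5, (x.1 ⊠ one) ∘ n6).

Definition coh_S (y : Pairs) (n : coherence_space) : coherence_space :=
  let: (n1, n2, n3, n4, n5, n6) := n in
  (n1 ∘ (y.1 ⊠ one) + n1 ∘ (one ⊠ y.1),
   (y.2 ⊠ one) ∘ n2 + (one ⊠ y.2) ∘ n2,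
   y.2 ∘ n3 + n3 ∘ (y.1 ⊠ one),
   y.2 ∘ n4 + n4 ∘ (one ⊠ y.1),
   (y.2 ⊠ one) ∘ n5 + n5 ∘ y.1,
   (one ⊠ y.2) ∘ n6 + n6 ∘ y.1).

Lemma pair6P c (m1 m3 m4 n1 n3 n4 : Mul) (m2 m5 m6 n2 n5 n6 : Com) :
  c *: ((m1, m2, m3, m4, m5, m6) : coherence_space) + (n1, n2, n3, n4, n5, n6)
  = (c *: m1 + n1, c *: m2 + n2, c *: m3 + n3,
     c *: m4 + n4, c *: m5 + n5, c *: m6 + n6).
Proof. by []. Qed.

Lemma pair6D (m1 m3 m4 n1 n3 n4 : Mul) (m2 m5 m6 n2 n5 n6 : Com) :
  ((m1, m2, m3, m4, m5, m6) : coherence_space) + (n1, n2, n3, n4, n5, n6)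
  = (m1 + n1, m2 + n2, m3 + n3, m4 + n4, m5 + n5, m6 + n6).
Proof. by []. Qed.

Ltac pair_lin := rewrite /= pair6P ?(lcompPl, lcompPr, ltensPl, ltensPr);
  rewrite ?(lcompPl, lcompPr);
  congr (_, _, _, _, _, _); lmod_ring.

Lemma coh_lin_linear : linear coh_lin.
Proof. by move=> c [x1 x2] [y1 y2]; rewrite /coh_lin; pair_lin. Qed.
HB.instance Definition _ := GRing.isLinear.Build F _ _ _ coh_lin coh_lin_linear.

Lemma coh_der_linear : linear coh_der.
Proof. by move=> c [x1 x2] [y1 y2]; rewrite /coh_der; pair_lin. Qed.
HB.instance Definition _ := GRing.isLinear.Build F _ _ _ coh_der coh_der_linear.

Lemma coh_bil_bilinear : bilinear_for
  (GRing.Scale.Law.clone _ _ *:%R _) (GRing.Scale.Law.clone _ _ *:%R _) coh_bil.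
Proof.
by split=> [[z1 z2] c [x1 x2] [y1 y2]|[z1 z2] c [x1 x2] [y1 y2]];
  rewrite /coh_bil; pair_lin.
Qed.
HB.instance Definition _ := bilinear_isBilinear.Build F _ _ _ _ _ coh_bil
  coh_bil_bilinear.

Lemma coh_L_bilinear : bilinear_for
  (GRing.Scale.Law.clone _ _ *:%R _) (GRing.Scale.Law.clone _ _ *:%R _) coh_L.
Proof.
split=> [[[[[[z1 z2] z3] z4] z5] z6] c [x1 x2] [y1 y2]
  |[z1 z2] c [[[[[x1 x2] x3] x4] x5] x6] [[[[[y1 y2] y3] y4] y5] y6]];
  rewrite /coh_L; pair_lin.
Qed.
HB.instance Definition _ := bilinear_isBilinear.Build F _ _ _ _ _ coh_L
  coh_L_bilinear.

Lemma coh_S_bilinear : bilinear_for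
  (GRing.Scale.Law.clone _ _ *:%R _) (GRing.Scale.Law.clone _ _ *:%R _) coh_S.
Proof.
split=> [[[[[[z1 z2] z3] z4] z5] z6] c [x1 x2] [y1 y2]
  |[z1 z2] c [[[[[x1 x2] x3] x4] x5] x6] [[[[[y1 y2] y3] y4] y5] y6]];
  rewrite /coh_S; pair_lin.
Qed.
HB.instance Definition _ := bilinear_isBilinear.Build F _ _ _ _ _ coh_S
  coh_S_bilinear.

Lemma coh_act_bilinear : bilinear_for
  (GRing.Scale.Law.clone _ _ *:%R _) (GRing.Scale.Law.clone _ _ *:%R _) coh_act.
Proof.
by split=> [[z1 z2] c [x1 x2] [y1 y2]|[z1 z2] c [x1 x2] [y1 y2]];
  rewrite /coh_act /= ?(lcompPl, lcompPr).
Qed.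
HB.instance Definition _ := bilinear_isBilinear.Build F _ _ _ _ _ coh_act
  coh_act_bilinear.

Lemma coh_linE f g : coh_lin (f, g) =
  (f ∘ μ, - (Δ ∘ g), - (μ ∘ (one ⊠ g)), - (μ ∘ (g ⊠ one)),
   (one ⊠ f) ∘ Δ, (f ⊠ one) ∘ Δ).
Proof. by []. Qed.

Lemma coh_bilE f g f' g' : coh_bil (f, g) (f', g') =
  (- (μ ∘ (f ⊠ f')), (g ⊠ g') ∘ Δ, g ∘ μ ∘ (f' ⊠ one),
   g ∘ μ ∘ (one ⊠ f'), - ((g ⊠ one) ∘ Δ ∘ f'), - ((one ⊠ g) ∘ Δ ∘ f')).
Proof. by []. Qed.

Lemma coh_derE f g : coh_der (f, g) =
  (f ∘ μ - (μ ∘ (f ⊠ one) + μ ∘ (one ⊠ f)),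
   (g ⊠ one) ∘ Δ + (one ⊠ g) ∘ Δ - Δ ∘ g,
   μ ∘ (f ⊠ one) + g ∘ μ - μ ∘ (one ⊠ g),
   μ ∘ (one ⊠ f) + g ∘ μ - μ ∘ (g ⊠ one),
   (one ⊠ f) ∘ Δ - (g ⊠ one) ∘ Δ - Δ ∘ f,
   (f ⊠ one) ∘ Δ - (one ⊠ g) ∘ Δ - Δ ∘ f).
Proof. by []. Qed.

Lemma coh_LE f g n1 n2 n3 n4 n5 n6 : coh_L (f, g) (n1, n2, n3, n4, n5, n6) =
  (f ∘ n1, n2 ∘ g, n3 ∘ (one ⊠ g), n4 ∘ (g ⊠ one),
   (one ⊠ f) ∘ n5, (f ⊠ one) ∘ n6).
Proof. by []. Qed.

Lemma coh_SE x z n1 n2 n3 n4 n5 n6 : coh_S (x, z) (n1, n2, n3, n4, n5, n6) =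
  (n1 ∘ (x ⊠ one) + n1 ∘ (one ⊠ x),
   (z ⊠ one) ∘ n2 + (one ⊠ z) ∘ n2,
   z ∘ n3 + n3 ∘ (x ⊠ one),
   z ∘ n4 + n4 ∘ (one ⊠ x),
   (z ⊠ one) ∘ n5 + n5 ∘ x,
   (one ⊠ z) ∘ n6 + n6 ∘ x).
Proof. by []. Qed.

Lemma pair6_congr (m1 m3 m4 n1 n3 n4 : Mul) (m2 m5 m6 n2 n5 n6 : Com) :
  m1 = n1 -> m2 = n2 -> m3 = n3 -> m4 = n4 -> m5 = n5 -> m6 = n6 ->
  (m1, m2, m3, m4, m5, m6) = (n1, n2, n3, n4, n5, n6) :> coherence_space.
Proof. by move=> -> -> -> -> -> ->. Qed.

Lemma coh_tangent_act_pair f g x z :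
  coh_lin (f ∘ x, z ∘ g) + (coh_bil (f, g) (f ∘ x, z ∘ g)
      + coh_bil (f ∘ x, z ∘ g) (f, g))
    = coh_L (f, g) (coh_der (x, z))
      + coh_S (x, z) (coh_lin (f, g) + coh_bil (f, g) (f, g)).
Proof.
rewrite !coh_linE !coh_bilE coh_derE coh_LE [X in coh_S _ X]pair6D coh_SE.
rewrite [X in _ + X = _]pair6D [LHS]pair6D [RHS]pair6D.
apply: pair6_congr;
  rewrite ?(lcompDl, lcompDr, lcompNl, lcompNr) ?lcompA
    ?(ltens_comp, ltens_compA) ?(lcomp1l, lcomp1r);
  lmod_ring.
Qed.

Lemma coh_tangent_act x y :
  qtangent coh_lin coh_bil x (coh_act x y)
    = coh_L x (coh_der y) + coh_S y (qeval coh_lin coh_bil x).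
Proof. by case: x y => [f g] [x z]; exact: coh_tangent_act_pair. Qed.

Lemma coh_evalE f g : qeval coh_lin coh_bil (f, g) =
  (f ∘ μ - μ ∘ (f ⊠ f),
   - (Δ ∘ g) + (g ⊠ g) ∘ Δ,
   - (μ ∘ (one ⊠ g)) + g ∘ μ ∘ (f ⊠ one),
   - (μ ∘ (g ⊠ one)) + g ∘ μ ∘ (one ⊠ f),
   (one ⊠ f) ∘ Δ - (g ⊠ one) ∘ Δ ∘ f,
   (f ⊠ one) ∘ Δ - (one ⊠ g) ∘ Δ ∘ f).
Proof.
by rewrite -[LHS]/(coh_lin (f, g) + coh_bil (f, g) (f, g)) coh_linE coh_bilE pair6D.
Qed.

Lemma coherence_eq0 (n1 n3 n4 : Mul) (n2 n5 n6 : Com) :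
  ((n1, n2, n3, n4, n5, n6) : coherence_space) = 0 <->
  [/\ forall a b, n1 (tens a b) = 0, forall a, n2 a = 0 &
      forall a b, n3 (tens a b) = 0] /\
  [/\ forall a b, n4 (tens a b) = 0, forall a, n5 a = 0 & forall a, n6 a = 0].
Proof.
have mul0 (n : Mul) : (forall a b, n (tens a b) = 0) -> n = 0.
  by move=> n0; apply: tens_lfun_ext => a b; rewrite n0 zero_lfunE.
have com0 (n : Com) : (forall a, n a = 0) -> n = 0.
  by move=> n0; apply/lfunP => a; rewrite n0 zero_lfunE.
split=> [[-> -> -> -> -> ->]|[[h1 h2 h3] [h4 h5 h6]]].
  by split; split=> *; rewrite zero_lfunE.
by rewrite (mul0 _ h1) (com0 _ h2) (mul0 _ h3) (mul0 _ h4) (com0 _ h5) (com0 _ h6).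
Qed.

Let lfunE' := (add_lfunE, opp_lfunE, lcompE, ltens_tens, lmulE, id_lfunE,
  ltens1lE, ltens1rE, ltensE).

Lemma sub_eq0 (V : zmodType) (u v : V) : u - v = 0 <-> u = v.
Proof. by split=> [/subr0_eq|->]//; rewrite subrr. Qed.

Lemma coherent_derivationE y : coherent_derivation B y <-> coh_der y = 0.
Proof.
split.
- move=> [h1 h2 h3 h4 h5 h6]; apply/coherence_eq0; split;
    [split=> [a b|a|a b]|split=> [a b|a|a]];
    rewrite !lfunE'.
  + by apply/sub_eq0/h1.
  + by apply/sub_eq0; rewrite h2.
  + by apply/sub_eq0; rewrite h4.
  + by apply/sub_eq0; rewrite h3.
  + by rewrite h6 [tmap _ _ _ + _]addrC addrK subrr.
  + by rewrite h5 [tmap _ _ _ + _]addrC addrK subrr.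
- move=> /coherence_eq0[[h1 h2 h3] [h4 h5 h6]].
  split=> [a b|a|a b|a b|a|a].
  + by have := h1 a b; rewrite !lfunE' => /sub_eq0.
  + by have := h2 a; rewrite !lfunE' => /sub_eq0 ->.
  + by have := h4 a b; rewrite !lfunE' => /sub_eq0 ->.
  + by have := h3 a b; rewrite !lfunE' => /sub_eq0 ->.
  + by have := h6 a; rewrite !lfunE' => /sub_eq0 <-; rewrite addrC subrK.
  + by have := h5 a; rewrite !lfunE' => /sub_eq0 <-; rewrite addrC subrK.
Qed.

Lemma coherent_automorphismE x : coherent_automorphism B x <->
  [/\ bijective x.1, bijective x.2 & qeval coh_lin coh_bil x = 0].
Proof.
case: x => f g; split=> /=.
- move=> [b1 b2 h1 h2 h3 h4 h5 h6]; split=> //.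
  rewrite coh_evalE; apply/coherence_eq0; split;
    [split=> [a b|a|a b]|split=> [a b|a|a]]; rewrite !lfunE'.
  + by apply/sub_eq0/h1.
  + by rewrite addrC; apply/sub_eq0/h2.
  + by rewrite addrC; apply/sub_eq0/h3.
  + by rewrite addrC; apply/sub_eq0/h4.
  + by apply/sub_eq0/h5.
  + by apply/sub_eq0/h6.
- move=> [b1 b2]; rewrite coh_evalE.
  move=> /coherence_eq0[[h1 h2 h3] [h4 h5 h6]]; split=> // [a b|a|a b|a b|a|a].
  + by have := h1 a b; rewrite !lfunE' => /sub_eq0.
  + by have := h2 a; rewrite !lfunE' addrC => /sub_eq0.
  + by have := h3 a b; rewrite !lfunE' addrC => /sub_eq0.
  + by have := h4 a b; rewrite !lfunE' addrC => /sub_eq0.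
  + by have := h5 a; rewrite !lfunE' => /sub_eq0.
  + by have := h6 a; rewrite !lfunE' => /sub_eq0.
Qed.

(** The witnesses [1 - φ^-1 φ] and [1 - ψ ψ^-1], built on the generalised
    inverses, are killed by [φ] on the left and by [ψ] on the right,
    so injectivity makes them vanish. *)
Lemma coh_act_inj (x : Pairs) : injective (coh_act x) <->
  bijective x.1 /\ bijective x.2.
Proof.
split=> [xinj|[b1 b2] [y1 y2] [z1 z2] [e1 e2]].
  have x0 y : coh_act x y = 0 -> y = 0.
    by move=> xy; apply: xinj; rewrite xy linear0r.
  split.
    apply: (@lfun_bij_comp _ _ _ (x.1^-1)%VF).
    have := x0 (\1%VF - (x.1^-1)%VF ∘ x.1, 0).
    rewrite /coh_act /= lcompDr lcompNr lcomp1r lcompA lcomp_inv_lfun.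
    by rewrite subrr linear0l => /(_ erefl) [] /subr0_eq.
  apply: (@lfun_bij_comp _ _ _ (x.2^-1)%VF); apply: lfun_left_inverse.
  have := x0 (0, \1%VF - x.2 ∘ (x.2^-1)%VF).
  rewrite /coh_act /= lcompDl lcompNl lcomp1l lcomp_inv_lfun.
  by rewrite subrr linear0r => /(_ erefl) [] /subr0_eq.
have [i1 _] := lfun_bij_inv b1; have [_ i2] := lfun_bij_inv b2.
congr (_, _).
  by rewrite -[y1]lcomp1l -[z1]lcomp1l -i1 -!lcompA e1.
by rewrite -[y2]lcomp1r -[z2]lcomp1r -i2 !lcompA e2.
Qed.

Lemma coh_L_inj (x : Pairs) : bijective x.1 -> bijective x.2 -> injective (coh_L x).
Proof.
case: x => f g /= b1 b2.
have [i1 j1] := lfun_bij_inv b1; have [i2 j2] := lfun_bij_inv b2.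
pose y : Pairs := (f^-1, g^-1)%VF.
apply: (@can_inj _ _ _ (coh_L y)) => -[[[[[n1 n2] n3] n4] n5] n6].
rewrite !coh_LE; apply: pair6_congr.
- by rewrite lcompA i1 lcomp1l.
- by rewrite -lcompA j2 lcomp1r.
- by rewrite ltens_compA j2 lcomp1l ltens11 lcomp1r.
- by rewrite ltens_compA j2 lcomp1l ltens11 lcomp1r.
- by rewrite lcompA ltens_comp i1 lcomp1l ltens11 lcomp1l.
- by rewrite lcompA ltens_comp i1 lcomp1l ltens11 lcomp1l.
Qed.

Lemma coh_act_one y : coh_act (one, one) y = y.
Proof. by case: y => y1 y2; rewrite /coh_act /= lcomp1l lcomp1r. Qed.

Lemma coh_L_one n : coh_L (one, one) n = n.
Proof.
case: n => [[[[[n1 n2] n3] n4] n5] n6]; rewrite coh_LE.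
by rewrite !ltens11 !lcomp1l !lcomp1r.
Qed.

End Coherent.

(** * Closure under the group and Lie algebra operations *)

Section CoherentClosure.
Variables (F : fieldType) (A : vectType F) (B : asiBialgebra A).
Local Notation Pairs := ('End(A) * 'End(A))%type.
Local Notation one := (\1%VF : 'End(A)).
Local Notation μ := (lmul B).
Local Notation Δ := (comul B).
Local Notation coh_lin := (coh_lin B).
Local Notation coh_bil := (coh_bil B).
Local Notation coh_der := (coh_der B).

Lemma coh_eval_eq0 f g : qeval coh_lin coh_bil (f, g) = 0 <->
  [/\ f ∘ μ = μ ∘ (f ⊠ f), (g ⊠ g) ∘ Δ = Δ ∘ g &
      g ∘ μ ∘ (f ⊠ one) = μ ∘ (one ⊠ g)] /\
  [/\ g ∘ μ ∘ (one ⊠ f) = μ ∘ (g ⊠ one),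
      (one ⊠ f) ∘ Δ = (g ⊠ one) ∘ Δ ∘ f &
      (f ⊠ one) ∘ Δ = (one ⊠ g) ∘ Δ ∘ f].
Proof.
rewrite coh_evalE; split.
  move=> [/subr0_eq e1 + + + /subr0_eq e5 /subr0_eq e6].
  by rewrite ![- _ + _]addrC => /subr0_eq e2 /subr0_eq e3 /subr0_eq e4.
move=> [[e1 e2 e3] [e4 e5 e6]].
by rewrite e1 e2 e3 e4 e5 e6 !subrr !addNr.
Qed.

Lemma coherent_automorphism_one : coherent_automorphism B (one, one).
Proof.
apply/coherent_automorphismE; split=> /=.
- by exists one => v; rewrite !id_lfunE.
- by exists one => v; rewrite !id_lfunE.
- by rewrite coh_evalE !ltens11 !(lcomp1l, lcomp1r) !subrr !addNr.
Qed.

Lemma lcomp_bij (f g : 'End(A)) :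
  bijective f -> bijective g -> bijective (f ∘ g : 'End(A)).
Proof.
move=> [f' fK f'K] [g' gK g'K].
exists (g' \o f') => v /=; first by rewrite lcompE fK gK.
by rewrite lcompE g'K f'K.
Qed.

Lemma coherent_automorphism_mul (x y : Pairs) :
  coherent_automorphism B x -> coherent_automorphism B y ->
  coherent_automorphism B (y.1 ∘ x.1, x.2 ∘ y.2).
Proof.
case: x y => [f g] [f' g'] /coherent_automorphismE[/= bf bg].
move=> /coh_eval_eq0[[e1 e2 e3] [e4 e5 e6]] /coherent_automorphismE[/= bf' bg'].
move=> /coh_eval_eq0[[k1 k2 k3] [k4 k5 k6]]; apply/coherent_automorphismE.
split=> /=; [exact: lcomp_bij|exact: lcomp_bij|apply/coh_eval_eq0].
have tl (p q : 'End(A)) : (p ∘ q) ⊠ one = (p ⊠ one) ∘ (q ⊠ one).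
  by rewrite ltens_comp lcomp1l.
have tr (p q : 'End(A)) : one ⊠ (p ∘ q) = (one ⊠ p) ∘ (one ⊠ q).
  by rewrite ltens_comp lcomp1l.
have tc (p q : 'End(A)) : (p ⊠ one) ∘ (one ⊠ q) = (one ⊠ q) ∘ (p ⊠ one).
  by rewrite !ltens_comp !lcomp1l !lcomp1r.
split; split.
- by rewrite -lcompA e1 lcompA k1 -lcompA ltens_comp.
- by rewrite -ltens_comp -lcompA k2 lcompA e2 lcompA.
- by rewrite tl tr !lcompA -[g ∘ g' ∘ _]lcompA -[g ∘ _ ∘ _]lcompA k3
    -!lcompA -tc !lcompA e3.
- by rewrite tl tr !lcompA -[g ∘ g' ∘ _]lcompA -[g ∘ _ ∘ _]lcompA k4
    -!lcompA tc !lcompA e4.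
- by rewrite tl tr -[LHS]lcompA e5 !lcompA -tc -[_ ∘ Δ]lcompA k5 !lcompA.
- by rewrite tl tr -[LHS]lcompA e6 !lcompA tc -[_ ∘ Δ]lcompA k6 !lcompA.
Qed.

Lemma coherent_automorphism_inv (x : Pairs) :
  coherent_automorphism B x -> coherent_automorphism B (x.1^-1, x.2^-1)%VF.
Proof.
case: x => [f g] /coherent_automorphismE[/= bf bg].
move=> /coh_eval_eq0[[e1 e2 e3] [e4 e5 e6]].
have [i1 j1] := lfun_bij_inv bf; have [i2 j2] := lfun_bij_inv bg.
set f' := (f^-1)%VF in i1 j1 *; set g' := (g^-1)%VF in i2 j2 *.
apply/coherent_automorphismE; split=> /=.
- exact: lfun_bij_comp j1.
- exact: lfun_bij_comp j2.
apply/coh_eval_eq0; split; split.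
- transitivity (f' ∘ (μ ∘ (f ⊠ f)) ∘ (f' ⊠ f')).
    by rewrite lcompA ltens_compA j1 ltens11 lcomp1r.
  by rewrite -e1 lcompA i1 lcomp1l.
- transitivity ((g' ⊠ g') ∘ (Δ ∘ g) ∘ g').
    by rewrite -!lcompA j2 lcomp1r.
  by rewrite -e2 lcompA ltens_comp i2 ltens11 lcomp1l.
- transitivity (g' ∘ (μ ∘ (one ⊠ g)) ∘ (f' ⊠ g')).
    by rewrite lcompA ltens_compA lcomp1l j2.
  by rewrite -e3 !lcompA i2 lcomp1l ltens_compA j1 lcomp1l.
- transitivity (g' ∘ (μ ∘ (g ⊠ one)) ∘ (g' ⊠ f')).
    by rewrite lcompA ltens_compA lcomp1l j2.
  by rewrite -e4 !lcompA i2 lcomp1l ltens_compA j1 lcomp1l.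
- transitivity ((g' ⊠ f') ∘ ((g ⊠ one) ∘ Δ ∘ f) ∘ f').
    by rewrite !lcompA ltens_comp i2 lcomp1r -lcompA j1 lcomp1r.
  by rewrite -e5 !lcompA ltens_comp i1 lcomp1r.
- transitivity ((f' ⊠ g') ∘ ((one ⊠ g) ∘ Δ ∘ f) ∘ f').
    by rewrite !lcompA ltens_comp i2 lcomp1r -lcompA j1 lcomp1r.
  by rewrite -e6 !lcompA ltens_comp i1 lcomp1r.
Qed.

(** Each of the six equations says that [μ] or [Δ] intertwines two maps that depend
    linearly on the pair and send the bracket of pairs to a commutator; the
    minus sign in the first factor is what makes this true for the mixed
    equations. *)
Lemma coh_der_bracket (x y : Pairs) : coh_der x = 0 -> coh_der y = 0 ->
  coh_der (- (x.1 ∘ y.1 - y.1 ∘ x.1), x.2 ∘ y.2 - y.2 ∘ x.2) = 0.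
Proof.
case: x y => [x z] [x' z']; rewrite !coh_derE /=.
move=> [/subr0_eq h1 /subr0_eq h2 /subr0_eq h3 /subr0_eq h4 /subr0_eq h5 /subr0_eq h6].
move=> [/subr0_eq k1 /subr0_eq k2 /subr0_eq k3 /subr0_eq k4 /subr0_eq k5 /subr0_eq k6].
have mv (V : zmodType) (u v w : V) : u + v = w -> v = w - u.
  by move=> <-; rewrite addrC addKr.
have E1 : x ∘ μ = μ ∘ (x ⊠ one + one ⊠ x) by rewrite lcompDr.
have F1 : x' ∘ μ = μ ∘ (x' ⊠ one + one ⊠ x') by rewrite lcompDr.
have E2 : (z ⊠ one + one ⊠ z) ∘ Δ = Δ ∘ z by rewrite lcompDl.
have F2 : (z' ⊠ one + one ⊠ z') ∘ Δ = Δ ∘ z' by rewrite lcompDl.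
have E3 : z ∘ μ = μ ∘ (one ⊠ z - x ⊠ one) by rewrite lcompDr lcompNr; exact: mv.
have F3 : z' ∘ μ = μ ∘ (one ⊠ z' - x' ⊠ one) by rewrite lcompDr lcompNr; exact: mv.
have E4 : z ∘ μ = μ ∘ (z ⊠ one - one ⊠ x) by rewrite lcompDr lcompNr; exact: mv.
have F4 : z' ∘ μ = μ ∘ (z' ⊠ one - one ⊠ x') by rewrite lcompDr lcompNr; exact: mv.
have E5 : (one ⊠ x - z ⊠ one) ∘ Δ = Δ ∘ x by rewrite lcompDl lcompNl.
have F5 : (one ⊠ x' - z' ⊠ one) ∘ Δ = Δ ∘ x' by rewrite lcompDl lcompNl.
have E6 : (x ⊠ one - one ⊠ z) ∘ Δ = Δ ∘ x by rewrite lcompDl lcompNl.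
have F6 : (x' ⊠ one - one ⊠ z') ∘ Δ = Δ ∘ x' by rewrite lcompDl lcompNl.
have G1 := lcompBr_intertwine E1 F1; have G2 := lcompBr_intertwine E2 F2.
have G3 := lcompBr_intertwine E3 F3; have G4 := lcompBr_intertwine E4 F4.
have G5 := lcompBr_intertwine E5 F5; have G6 := lcompBr_intertwine E6 F6.
apply: pair6_congr;
  [rewrite lcompNl G1|rewrite -G2|rewrite G3|rewrite G4
  |rewrite lcompNr -G5|rewrite lcompNr -G6];
  rewrite ?(ltensDl, ltensDr, ltensNl, ltensNr)
    ?(lcompDl, lcompDr, lcompNl, lcompNr) ?lcompA
    ?(ltens_comp, ltens_compA) ?(lcomp1l, lcomp1r); lmod_ring.
Qed.

End CoherentClosure.

(** * The Lie group of coherent automorphisms *)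

Theorem theorem3p23 (R : realType) (A : vectType R) (B : asiBialgebra A) :
  [/\ closed_Lie_subgroup [set p | coherent_automorphism B p],
      Lie_subalgebra [set p | coherent_derivation B p] &
      Lie_algebra_of [set p | coherent_automorphism B p]
        = [set p | coherent_derivation B p]].
Proof.
pose q : {bilinear _ -> _ -> _} := coh_bil B.
pose l : {linear _ -> _} := coh_lin B.
have autE p : coherent_automorphism B p <->
    injective (coh_act p) /\ qeval l q p = 0.
  rewrite coherent_automorphismE; split=> [[b1 b2 ->]|[/coh_act_inj[b1 b2] ->]//].
  by split=> //; apply/coh_act_inj.
have Linj p : coherent_automorphism B p -> injective (coh_L p).
  by move=> [b1 b2 _ _ _ _ _ _]; exact: coh_L_inj.
have act_tangent := coh_tangent_act B.
split; first split.
- by move=> p [].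
- exact: coherent_automorphism_one.
- move=> x y Gx Gy; have := coherent_automorphism_mul Gx Gy.
  by rewrite lcomp.unlock.
- by move=> x; exact: coherent_automorphism_inv.
- exists [set x | qeval l q x = 0]; split; first exact: qeval_zero_vclosed.
  apply/seteqP; split=> p /=.
    by move=> /coherent_automorphismE[].
  by move=> [[b1 b2] F0]; apply/coherent_automorphismE.
- exists (\dim (lker (linfun (coh_der B)))) => p Gp.
  have [pinj Fp] := (autE p).1 Gp.
  have [U [U' [f [g [oU fg Uinj UF]]]]] :=
    zero_set_chart act_tangent Fp pinj (Linj p Gp).
  exists U, U', f, g, (lker (linfun (qtangent l q p))); split=> //.
    exact: (dim_ker_tangent act_tangent Fp pinj (Linj p Gp)).
  move=> x Ux; rewrite -(UF x Ux) /=; split=> [/autE[]//|Fx].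
  by apply/autE; split=> //; exact: Uinj.
- split=> [|x y|c x|x y] /=.
  + by apply/coherent_derivationE; rewrite linear0.
  + move=> /coherent_derivationE Dx /coherent_derivationE Dy.
    by apply/coherent_derivationE; rewrite linearD /= Dx Dy addr0.
  + move=> /coherent_derivationE Dx.
    by apply/coherent_derivationE; rewrite linearZ /= Dx scaler0.
  + move=> /coherent_derivationE Dx /coherent_derivationE Dy.
    apply/coherent_derivationE; have := coh_der_bracket Dx Dy.
    by rewrite lcomp.unlock.
have G1 := coherent_automorphism_one B.
have [inj1 F1] := (autE _).1 G1.
have T1 X : linfun (qtangent l q (\1%VF, \1%VF)) X = coh_der B X.
  have act1 := coh_act_one X; have L1 := coh_L_one (coh_der B X).
  rewrite lfunE -[RHS]L1 -[in LHS]act1.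
  exact: (tangent_act act_tangent F1 X).
apply/seteqP; split=> X.
  move=> [e [c [e0 cs cG c0 cX]]]; apply/coherent_derivationE; rewrite -T1.
  apply: (@zero_set_curve_tangent _ _ _ l q _ e c X) => //.
    by have [dc _] := cs 1%N; apply: dc; rewrite /= in_itv /= oppr_lt0 e0.
  by move=> t /cG /autE[].
move=> /coherent_derivationE DX.
have TX : linfun (qtangent l q (\1%VF, \1%VF)) X = 0 by rewrite T1.
have [e [c [e0 cs cF c0 cX]]] := zero_set_curve act_tangent F1 inj1 (Linj _ G1) TX.
exists e, c; split=> // t te; have [Ft tinj] := cF t te.
by apply/autE.
Qed.
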